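(* Consider a fermionic lattice system on $\mathbb{Z}^D$ with $k$-body potential $\Phi$, Hamiltonians $H_\Lambda$ and time-evolutions $\tau^\Lambda_t$. Assume that there exists a real-valued function $h(t,r)$, defined for $t\ge0$ and distances $r\ge 0$, with $h(0,r)=0$ for $r>0$ and differentiable in $t$ (one-sidedly at $t=0$), such that for every finite subset $\Lambda\subset\mathbb{Z}^D$, any two points $x\neq y$ in $\Lambda$, any two disjoint finite auxiliary fermionic systems $S_1,S_2$ and all $t\ge 0$, $$C^\Lambda_{x,y}(t):=\max_{A,B}\frac{\|[\tau^\Lambda_t(A),B]\|}{\|A\|\,\|B\|}\le h(t,|x-y|),$$ where the maximization is over nonzero even operators $A\in\mathcal{A}^+_{\{x\}\cup S_1}$ and $B\in\mathcal{A}^+_{\{y\}\cup S_2}$. Then there exists a constant $m_k$ depending only on $k$ and, for every finite $\Lambda\subset\mathbb{Z}^D$, a $k$-body (fermionic) potential $\hat\Phi_\Lambda$ on $\Lambda$ giving rise to the same time-evolution $\tau^\Lambda_t$, such that $$\|\hat\Phi_\Lambda(X)\|\le m_k\,\partial_t h\big(0,\mathrm{diam}(X)\big)\qquad\text{for all }X\subseteq\Lambda\text{ with }|X|\ge2.$$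
   Context: To each $x\in\mathbb{Z}^D$ are associated $d$ fermionic modes with annihilation and creation operators $f_{x,j},f_{x,j}^\dagger$, $j\in\{1,\dots,d\}$, satisfying the canonical anti-commutation relations $\{f_{x,j},f_{y,k}^\dagger\}=\delta_{x,y}\delta_{j,k}\mathbb{1}$, $\{f_{x,j},f_{y,k}\}=\{f^\dagger_{x,j},f^\dagger_{y,k}\}=0$. An auxiliary fermionic system $S$ is a finite collection of $|S|$ further modes $f_s,f_s^\dagger$, which satisfy the canonical anti-commutation relations among themselves and anti-commute with all operators $f_{x,j},f_{x,j}^\dagger$ (and with those of any other, disjoint, auxiliary system). For a finite collection $X$ of lattice sites and/or auxiliary modes, $\mathcal{A}_X$ is the (full matrix) algebra generated by all creation and annihilation operators of modes in $X$, and $\mathcal{A}_X^+\subset\mathcal{A}_X$ is the subalgebra of even operators, i.e. those spanned by monomials in an even number of creation and annihilation operators; equivalently those commuting with the parity operator $P_X=\prod_{m}(-1)^{f_m^\dagger f_m}$, the product over all modes $m$ in $X$. $\|\cdot\|$ is the operator norm, $|x-y|$ the graph distance on $\mathbb{Z}^D$, $\mathrm{diam}(X)=\sup_{x,y\in X}|x-y|$, and $|X|$ the number of lattice sites in $X$. A (fermionic) potential associates to each finite $X\subset\mathbb{Z}^D$ an even operator $\Phi(X)=\Phi(X)^\dagger\in\mathcal{A}_X^+$; a potential on $\Lambda$ is such an assignment for subsets $X\subseteq\Lambda$ only. It is $k$-body if $\Phi(X)=0$ whenever $|X|>k$. For finite $\Lambda$, $H_\Lambda=\sum_{X\subseteq\Lambda}\Phi(X)$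 and $\tau^\Lambda_t(A)=e^{iH_\Lambda t}Ae^{-iH_\Lambda t}$, also for operators $A$ acting on $\Lambda$ together with auxiliary systems (which are left invariant by the evolution). A potential $\hat\Phi_\Lambda$ on $\Lambda$ gives rise to $\tau^\Lambda_t$ if the Hamiltonian $\sum_{X\subseteq\Lambda}\hat\Phi_\Lambda(X)$ generates $\tau^\Lambda_t$ in this way. *)

(* Defs.v *)
From mathcomp Require Import all_boot all_order all_algebra finmap complex ring.
From mathcomp Require Import all_classical all_reals all_analysis.
Import Order.TTheory GRing.Theory Num.Theory numFieldNormedType.Exports.

Set Implicit Arguments.
Unset Strict Implicit.
Unset Printing Implicit Defensive.

Local Open Scope classical_set_scope.
Local Open Scope fset_scope.
Local Open Scope complex_scope.
Local Open Scope ring_scope.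

(* A single Fock space carries all modes, those of the lattice and those of   *)
(* the auxiliary systems, so that every local algebra is a set of operators   *)
(* on one space and no embedding of one local algebra into another is needed. *)
Section Fock.
Variables (R : realType) (M : countType).

(* Amplitudes in the occupation basis; [I] is the set of occupied modes.  The *)
(* vectors of the (algebraic) Fock space are those of finite support, see     *)
(* [fock_vec]; the operators below make sense on all amplitude functions.     *)
Definition fock := {fset M} -> R[i].

Definition op := fock -> fock.

Definition fock_vec (psi : fock) : Prop := finite_set [set I | psi I != 0].

Definition inner (phi psi : fock) : R[i] :=
  \sum_(I \in [set: {fset M}]) ((phi I)^*)%C * psi I.

Definition fock_norm (psi : fock) : R := Num.sqrt (complex.Re (inner psi psi)).

Definition opnorm (A : op) : R :=
  sup [set fock_norm (A psi) | psi in
        [set psi | fock_vec psi /\ fock_norm psi <= 1]].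

Definition selfadjoint (A : op) : Prop :=
  forall phi psi, fock_vec phi -> fock_vec psi ->
    inner phi (A psi) = inner (A phi) psi.

(* Jordan-Wigner sign; the modes are ordered by [pickle]. *)
Definition jw (m : M) (I : {fset M}) : R[i] :=
  (-1) ^+ #|` [fset j in I | (choice.pickle j < choice.pickle m)%N]|.

Definition annih (m : M) : op := fun psi I =>
  if m \in I then 0 else jw m I * psi (m |` I).

Definition creat (m : M) : op := fun psi I =>
  if m \in I then jw m I * psi (I `\ m) else 0.

Definition letter := (bool * M)%type.

Definition ladder (l : letter) : op := if l.1 then creat l.2 else annih l.2.

Definition monomial (w : seq letter) : op :=
  foldr (fun l A => ladder l \o A) idfun w.

Definition lincomb (s : seq (R[i] * seq letter)) : op := fun psi I =>
  \sum_(p <- s) p.1 * monomial p.2 psi I.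

Definition over (X : pred M) (w : seq letter) : bool :=
  all (fun l => X l.2) w.

(* The algebra generated by the creation and annihilation operators of the    *)
(* modes in [X], and its even part.                                           *)
Definition alg (X : pred M) : set op :=
  [set A | exists2 s, all (fun p => over X p.2) s & A = lincomb s].

Definition even_alg (X : pred M) : set op :=
  [set A | exists2 s,
     all (fun p => over X p.2 && ~~ odd (size p.2)) s & A = lincomb s].

Definition op0 : op := fun _ _ => 0.

Definition comm (A B : op) : op := fun psi I => A (B psi) I - B (A psi) I.

(* Limit of the partial sums of the exponential series, taken on each         *)
(* amplitude, separately in the real and the imaginary part.  A local operator *)
(* couples each I to finitely many J only, those equal to I off its modes.    *)
Definition expop_sum (A : op) (psi : fock) (I : {fset M}) (n : nat) : R[i] :=
  \sum_(k < n) (k`!%:R)^-1 * iter k A psi I.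

Definition expop (A : op) : op := fun psi I =>
  limn (fun n => complex.Re (expop_sum A psi I n)) +i*
  limn (fun n => complex.Im (expop_sum A psi I n)).

(* e^{iHt} A e^{-iHt} *)
Definition evolve (H : op) (t : R) (A : op) : op :=
  expop (fun psi I => (0 +i* t) * H psi I) \o A \o
  expop (fun psi I => (0 -i* t) * H psi I).

Definition jw2 (m n : M) : R[i] :=
  if (choice.pickle m < choice.pickle n)%N then -1 else 1.

Lemma jw2C (m n : M) : m != n -> jw2 n m = - jw2 m n.
Proof.
rewrite /jw2; have : (m != n) = (choice.pickle m != choice.pickle n).
  by rewrite (inj_eq (pcan_inj choice.pickleK)).
by move=> -> nmn; case: ltngtP nmn => // _ _; rewrite opprK.
Qed.

Lemma jw_fset1U (m n : M) (I : {fset M}) : m \notin I ->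
  jw n (m |` I) = jw2 m n * jw n I.
Proof.
move=> mI; rewrite /jw /jw2; case: ifP => lt_mn.
  rewrite (_ : [fset j in m |` I | _] =
    m |` [fset j in I | (choice.pickle j < choice.pickle n)%N]).
    by rewrite cardfsU1 !inE /= (negPf mI) /= exprS.
  apply/fsetP => j; rewrite !inE /=.
  by case: eqP => [->|//] /=; rewrite lt_mn.
rewrite mul1r; congr (_ ^+ _); congr #|` _|.
apply/fsetP => j; rewrite !inE /=.
by case: eqP => [->|//] /=; rewrite lt_mn andbF.
Qed.

Lemma jw_fsetD1 (m n : M) (I : {fset M}) : m \in I ->
  jw n (I `\ m) = jw2 m n * jw n I.
Proof.
move=> mI; have := @jw_fset1U m n (I `\ m); rewrite fsetD1K // => -> //.
  by rewrite mulrA /jw2; case: ifP; rewrite ?mulrNN !mulr1 mul1r.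
by rewrite !inE eqxx.
Qed.

Lemma jwK (m : M) (I : {fset M}) : jw m I * jw m I = 1.
Proof. by rewrite /jw -expr2 sqrr_sign. Qed.

Lemma jw2mm (m : M) : jw2 m m = 1.
Proof. by rewrite /jw2 ltnn. Qed.

(* The canonical anti-commutation relations *)
Lemma car_annih_creat (m n : M) (psi : fock) (I : {fset M}) :
  annih m (creat n psi) I + creat n (annih m psi) I = (m == n)%:R * psi I.
Proof.
rewrite /annih /creat !inE; have [<-|nmn] := eqVneq m n.
  rewrite mul1r; case: ifPn => mI /=.
    by rewrite fsetD1K // jw_fsetD1 // jw2mm mul1r add0r mulrA jwK mul1r.
  by rewrite fsetU1K // jw_fset1U // jw2mm mul1r addr0 mulrA jwK mul1r.
rewrite mul0r /=.
case: ifPn => mI; case: ifPn => nI; rewrite ?mulr0 ?addr0 //.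
have -> : (m |` I) `\ n = m |` (I `\ n).
  apply/fsetP => j; rewrite !inE.
  by have [->|//] := eqVneq j m; rewrite nmn.
rewrite jw_fset1U // jw_fsetD1 // (jw2C nmn); ring.
Qed.

Lemma car_annih (m n : M) (psi : fock) (I : {fset M}) :
  annih m (annih n psi) I + annih n (annih m psi) I = 0.
Proof.
rewrite /annih !inE; have [<-|nmn] := eqVneq m n.
  by rewrite /=; case: ifP => _; rewrite ?mulr0 addr0.
rewrite /=; case: (boolP (m \in I)) => mI /=; case: (boolP (n \in I)) => nI;
  rewrite ?mulr0 ?addr0 //.
rewrite !jw_fset1U // (jw2C nmn) fsetUCA; ring.
Qed.

Lemma car_creat (m n : M) (psi : fock) (I : {fset M}) :
  creat m (creat n psi) I + creat n (creat m psi) I = 0.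
Proof.
rewrite /creat !inE; have [<-|nmn] := eqVneq m n.
  by rewrite /=; case: ifP => _; rewrite ?mulr0 addr0.
rewrite /=; case: (boolP (m \in I)) => mI /=; case: (boolP (n \in I)) => nI;
  rewrite ?mulr0 ?addr0 //.
rewrite !jw_fsetD1 // (jw2C nmn) fsetDDl fsetDDl [[fset n] `|` _]fsetUC.
ring.
Qed.

Lemma creat_adjoint (m : M) (phi psi : fock) :
  inner phi (annih m psi) = inner (creat m phi) psi.
Proof.
have supp (P : set {fset M}) (F : {fset M} -> R[i]) :
    (forall I, ~ P I -> F I = 0) ->
    \sum_(I \in [set: {fset M}]) F I = \sum_(I \in P) F I.
  move=> F0; apply/esym/fsbig_widen => // I [_ /F0] //.
rewrite /inner (supp [set I : {fset M} | m \notin I]); last first.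
  by move=> I /negP; rewrite negbK /annih => ->; rewrite mulr0.
rewrite (supp [set I : {fset M} | m \in I]); last first.
  by move=> I /negP mI; rewrite /creat (negPf mI) conjc0 mul0r.
rewrite [RHS](@reindex_fsbig _ _ _ _ _ (fun I : {fset M} => m |` I)
  [set I : {fset M} | m \notin I]).
  apply: eq_fsbigr => I; rewrite inE /= => mI.
  rewrite /annih /creat (negPf mI) in_fset1U eqxx /= fsetU1K //.
  rewrite jw_fset1U // jw2mm mul1r rmorphM /= {2}/jw rmorph_sign mulrCA mulrA.
  by [].
split => [I /= mI|I J|I /= mI]; first by rewrite in_fset1U eqxx.
  rewrite !inE /= => mI mJ eIJ.
  by rewrite -(fsetU1K mI) eIJ fsetU1K.
by exists (I `\ m); rewrite ?fsetD1K //= !inE eqxx.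
Qed.

End Fock.

(* Z^D with its graph distance, the l^1 distance *)
Definition site (D : nat) := {ffun 'I_D -> int}.

Definition gdist (D : nat) (x y : site D) : nat :=
  \sum_(i < D) `|(x i - y i)%R|%N.

Definition diam (D : nat) (X : {fset site D}) : nat :=
  \max_(x <- X) \max_(y <- X) gdist x y.

(* [inl (x, j)] is the j-th mode at x; the auxiliary modes are [inr s] with   *)
(* s a natural number, and an auxiliary system is a finite set of such s.     *)
Definition mode (D d : nat) := (site D * 'I_d + nat)%type.

Definition modes (D d : nat) (X : {fset site D}) (S : {fset nat}) :
    pred (mode D d) :=
  fun m => match m with inl (x, _) => x \in X | inr s => s \in S end.

Section Lattice.
Variables (R : realType) (D d : nat).
Let lop := op R (mode D d).
Implicit Types (Phi : {fset site D} -> lop) (L : {fset site D}).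

Definition potential_on (L : {fset site D}) Phi : Prop :=
  forall X, X `<=` L -> even_alg (modes X fset0) (Phi X) /\ selfadjoint (Phi X).

Definition kbody_on (L : {fset site D}) (k : nat) Phi : Prop :=
  forall X, X `<=` L -> (k < #|` X|)%N -> Phi X = @op0 _ _.

Definition potential Phi : Prop := forall L, potential_on L Phi.

Definition kbody (k : nat) Phi : Prop := forall L, kbody_on L k Phi.

Definition hamiltonian Phi L : lop := fun psi I =>
  \sum_(X <- fpowerset L) Phi X psi I.

Definition tau Phi L (t : R) (A : lop) : lop := evolve (hamiltonian Phi L) t A.

(* The maximum, as a supremum in the extended reals: it is attained, because  *)
(* the operators involved range over finite-dimensional algebras.             *)
Definition Cmax Phi L (x y : site D) (S1 S2 : {fset nat}) (t : R) : \bar R :=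
  ereal_sup [set z | exists A B : lop,
    [/\ even_alg (modes [fset x] S1) A, even_alg (modes [fset y] S2) B,
        A <> @op0 _ _, B <> @op0 _ _ &
        z = (opnorm (comm (tau Phi L t A) B) / (opnorm A * opnorm B))%:E]].

(* Equality of the evolutions on all operators on L and auxiliary modes *)
Definition same_evolution L Phi Phi' : Prop :=
  forall (S : {fset nat}) (t : R) (A : lop),
    alg (modes L S) A -> tau Phi' L t A = tau Phi L t A.

End Lattice.

Definition dquot0 (R : realType) (f : R -> R) : R -> R :=
  fun t => (f t - f 0) / t.

(* The derivative at 0 from the right *)
Definition rderiv0 (R : realType) (f : R -> R) : R :=
  lim (dquot0 f t @[t --> 0^'+]).

Definition differentiable_ge0 (R : realType) (f : R -> R) : Prop :=
  (forall t, 0 < t -> derivable f t 1) /\ cvg (dquot0 f t @[t --> 0^'+]).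

(* Main.v *)
Require Import Defs.
From mathcomp Require Import all_boot all_order all_algebra finmap complex ring lra.
From mathcomp Require Import all_classical all_reals all_analysis.
Import Order.TTheory GRing.Theory Num.Theory numFieldNormedType.Exports.
Set Implicit Arguments.
Unset Strict Implicit.
Unset Printing Implicit Defensive.
Local Open Scope classical_set_scope.
Local Open Scope fset_scope.
Local Open Scope complex_scope.
Local Open Scope ring_scope.

(* Write each operator as a combination of words in Majorana operators
   c = f + f^* and i(f^* - f).  For a Majorana operator c, the map
   A |-> (A + cAc)/2 keeps the even words that contain c an even number of
   times and kills the others.  Composing these maps over the modes at x gives
   E_x, which removes x from the support of an even operator, and
     hPhi(X) = prod_(x in X) (1 - E_x) prod_(x in L \ X) E_x (H_L).
   The sum over X is H_L, and hPhi(X) = 0 when |X| > k because some 1 - E_x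
   kills each term of H_L.  Choose x <> y in X at distance diam X:
   (1 - E_y)(1 - E_x) H_L is a convex combination of operators
   (H - AHA^-1) - B(H - AHA^-1)B^-1 = [[H,A],B] A^-1 B^-1 with A, B unitary
   words at x and y, and the derivative of the assumed bound at t = 0 controls
   [[H,A],B].  The other factors 1 - E_z cost 2 each, whence m_k = 2^k. *)

(** * Norms of finitely supported vectors *)

(** On even operators E_x is the normalized partial trace over the modes at x. Writing it as an
    average of unitary conjugations makes it a contraction whatever the number d of modes per site,
    which keeps d and D out of the constant. Fermionic signs are the obstacle: conjugation by c
    fixes a word without c only if the word is even, and the assumed bound concerns even operators,
    while the averages at a site also involve odd words. An odd word is therefore completed by one
    auxiliary Majorana operator, which leaves its conjugation action on H unchanged. Even words at
    distinct sites commute, so [tau_t(A), B] vanishes at t = 0 and has first-order term it[[H,A],B];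
    this is why the slope at 0 of a bound that starts from 0 controls the double commutator. On the
    analytic side, operators are maps on all amplitude functions over infinitely many modes. Each
    one in play changes finitely many modes only, so a vector of finite support stays in a
    finite-dimensional space, even under the exponential. *)

Section FockNorm.
Variables (R : realType) (M : countType).
Notation fock := (fock R M).
Notation op := (op R M).
Implicit Types (phi psi : fock) (A B : op) (T : {fset {fset M}}).

Definition supp_in T phi : Prop := forall I, I \notin T -> phi I = 0.

Lemma fock_vecP phi : fock_vec phi <-> exists T, supp_in T phi.
Proof.
split=> [/finite_fsetP[T eT]|[T sT]].
  exists T => I IT; apply: contraNeq IT => nz.
  by have : [set J | phi J != 0] I by []; rewrite eT.
apply: (@sub_finite_set _ _ [set` T]) => //= I /= nz.
by apply: contraNT nz => /sT ->.
Qed.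

Lemma supp_inW T T' phi : supp_in T phi -> (T `<=` T')%fset -> supp_in T' phi.
Proof. by move=> sT sTT' I IT'; apply: sT; apply: contraNN IT' => /(fsubsetP sTT'). Qed.

Lemma fock_vec2 phi psi : fock_vec phi -> fock_vec psi ->
  exists T, supp_in T phi /\ supp_in T psi.
Proof.
move=> /fock_vecP[T1 s1] /fock_vecP[T2 s2]; exists (T1 `|` T2)%fset.
by split; [apply: (supp_inW s1)|apply: (supp_inW s2)];
  rewrite ?fsubsetUl ?fsubsetUr.
Qed.

Lemma fock_vec0 : fock_vec (0 : fock).
Proof. by apply/fock_vecP; exists fset0. Qed.

Lemma supp_inD T phi psi :
  supp_in T phi -> supp_in T psi -> supp_in T (phi + psi).
Proof. by move=> s1 s2 I IT; rewrite fctE s1 // s2 // addr0. Qed.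

Lemma fock_vecD phi psi : fock_vec phi -> fock_vec psi -> fock_vec (phi + psi).
Proof.
move=> f1 f2; have [T [s1 s2]] := fock_vec2 f1 f2.
by apply/fock_vecP; exists T; apply: supp_inD.
Qed.

Lemma supp_inZ T a phi : supp_in T phi -> supp_in T (a *: phi).
Proof. by move=> s1 I IT; rewrite fctE s1 // scaler0. Qed.

Lemma fock_vecZ a phi : fock_vec phi -> fock_vec (a *: phi).
Proof.
by move=> /fock_vecP[T s]; apply/fock_vecP; exists T; apply: supp_inZ.
Qed.

Lemma innerE T phi psi : supp_in T phi \/ supp_in T psi ->
  inner phi psi = \sum_(I <- T) (phi I)^*%C * psi I.
Proof.
move=> sT; rewrite /inner -(@fsbig_widen _ _ _ _ [set` T]) //.
  by rewrite [RHS]fsbig_seq ?fset_uniq.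
by move=> I [_ /negP IT]; case: sT => /(_ _ IT) /= ->; rewrite ?conjc0 ?mul0r ?mulr0.
Qed.

Lemma innerDr chi phi psi : fock_vec phi -> fock_vec psi ->
  inner chi (phi + psi) = inner chi phi + inner chi psi.
Proof.
move=> f1 f2; have [T [s1 s2]] := fock_vec2 f1 f2.
rewrite !(@innerE T); [|by right..|by right; apply: supp_inD].
by rewrite -big_split; apply: eq_bigr => I _ /=; rewrite mulrDr.
Qed.

Lemma innerDl chi phi psi : fock_vec phi -> fock_vec psi ->
  inner (phi + psi) chi = inner phi chi + inner psi chi.
Proof.
move=> f1 f2; have [T [s1 s2]] := fock_vec2 f1 f2.
rewrite !(@innerE T); [|by left..|by left; apply: supp_inD].
by rewrite -big_split; apply: eq_bigr => I _ /=; rewrite rmorphD mulrDl.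
Qed.

Lemma innerZr a phi psi : fock_vec psi ->
  inner phi (a *: psi) = a * inner phi psi.
Proof.
move=> /fock_vecP[T s]; rewrite !(@innerE T); try by right=> //; apply: supp_inZ.
by rewrite mulr_sumr; apply: eq_bigr => I _; rewrite mulrCA.
Qed.

Lemma innerZl a phi psi : fock_vec phi ->
  inner (a *: phi) psi = a^*%C * inner phi psi.
Proof.
move=> /fock_vecP[T s]; rewrite !(@innerE T); try by left=> //; apply: supp_inZ.
by rewrite mulr_sumr; apply: eq_bigr => I _; rewrite rmorphM mulrA.
Qed.

(** Kept as an element of [R], whereas the norm of [R[i]] takes its values in [R[i]]. *)
Definition sqmod (z : R[i]) : R := (complex.Re z) ^+ 2 + (complex.Im z) ^+ 2.

Lemma sqmod_ge0 z : 0 <= sqmod z.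
Proof. by rewrite addr_ge0 ?sqr_ge0. Qed.

Lemma sqmodM z w : sqmod (z * w) = sqmod z * sqmod w.
Proof. by case: z w => a b [c d]; rewrite /sqmod /=; ring. Qed.

Lemma fock_normE T phi : supp_in T phi ->
  fock_norm phi = Num.sqrt (\sum_(I <- T) sqmod (phi I)).
Proof.
move=> sT; rewrite /fock_norm (innerE (or_introl sT)); congr Num.sqrt.
rewrite raddf_sum; apply: eq_bigr => I _.
by case: (phi I) => a b; rewrite /sqmod /=; ring.
Qed.

Lemma fock_norm_sqr T phi : supp_in T phi ->
  fock_norm phi ^+ 2 = \sum_(I <- T) sqmod (phi I).
Proof.
by move=> sT; rewrite (fock_normE sT) sqr_sqrtr // sumr_ge0 // => I _; apply: sqmod_ge0.
Qed.

Lemma fock_norm_ge0 phi : 0 <= fock_norm phi.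
Proof. exact: sqrtr_ge0. Qed.

Lemma fock_norm0 : fock_norm (0 : fock) = 0.
Proof. by rewrite (@fock_normE fset0) // big_seq_fset0 sqrtr0. Qed.

Lemma fock_normZ a phi : fock_vec phi ->
  fock_norm (a *: phi) = Num.sqrt (sqmod a) * fock_norm phi.
Proof.
move=> /fock_vecP[T s]; rewrite !(@fock_normE T) //; last exact: supp_inZ.
rewrite -sqrtrM ?sqmod_ge0 // mulr_sumr; congr Num.sqrt.
by apply: eq_bigr => I _; rewrite -sqmodM.
Qed.

Lemma fock_normZ_eq a c phi : fock_vec phi -> 0 <= c -> sqmod a = c ^+ 2 ->
  fock_norm (a *: phi) = c * fock_norm phi.
Proof. by move=> fp c0 e; rewrite fock_normZ // e sqrtr_sqr ger0_norm. Qed.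

Lemma fock_normN phi : fock_vec phi -> fock_norm (- phi) = fock_norm phi.
Proof.
move=> fp; rewrite -scaleN1r (@fock_normZ_eq _ 1) ?mul1r //.
by rewrite /sqmod /=; ring.
Qed.

(** Weighted Young inequality: the difference of the two sides is a sum of squares divided by s. It
    stands in for Cauchy-Schwarz in the triangle inequality. *)
Lemma sqmodD_le (s : R) z w : 0 < s ->
  sqmod (z + w) <= (1 + s) * sqmod z + (1 + s^-1) * sqmod w.
Proof.
move=> s0; case: z w => a b [c d]; rewrite /sqmod /= -subr_ge0.
have -> : (1 + s) * (a ^+ 2 + b ^+ 2) + (1 + s^-1) * (c ^+ 2 + d ^+ 2) -
  ((a + c) ^+ 2 + (b + d) ^+ 2) =
  s^-1 * ((s * a - c) ^+ 2 + (s * b - d) ^+ 2) by field; rewrite gt_eqF.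
by rewrite mulr_ge0 ?invr_ge0 ?(ltW s0) // addr_ge0 ?sqr_ge0.
Qed.

Lemma fock_norm_eq0 phi : fock_vec phi -> fock_norm phi = 0 -> phi = 0.
Proof.
move=> /fock_vecP[T s] n0; apply/funext => I.
have [IT|/s //] := boolP (I \in T).
have := fock_norm_sqr s; rewrite n0 expr0n /= => /esym/eqP.
rewrite psumr_eq0; last by move=> *; apply: sqmod_ge0.
move=> /allP/(_ _ IT)/=; rewrite /sqmod; case: (phi I) => a b /=.
by rewrite paddr_eq0 ?sqr_ge0 // !sqrf_eq0 => /andP[/eqP-> /eqP->].
Qed.

(** [sqmodD_le] is summed over configurations with the weight s = q / p, for which the right-hand
    side is exactly (p + q)^2. Vanishing norms are treated apart to keep s positive. *)
Lemma fock_normD phi psi : fock_vec phi -> fock_vec psi ->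
  fock_norm (phi + psi) <= fock_norm phi + fock_norm psi.
Proof.
move=> f1 f2; have [p0|p0] := eqVneq (fock_norm phi) 0.
  by rewrite (fock_norm_eq0 f1 p0) add0r fock_norm0 add0r.
have [q0|q0] := eqVneq (fock_norm psi) 0.
  by rewrite (fock_norm_eq0 f2 q0) addr0 fock_norm0 addr0.
set p := fock_norm phi in p0 *; set q := fock_norm psi in q0 *.
have pp : 0 < p by rewrite lt_def p0 fock_norm_ge0.
have qp : 0 < q by rewrite lt_def q0 fock_norm_ge0.
have [T [s1 s2]] := fock_vec2 f1 f2.
rewrite -(@ler_pXn2r _ 2) ?nnegrE ?fock_norm_ge0 ?addr_ge0 ?(ltW pp) ?(ltW qp) //.
rewrite (fock_norm_sqr (supp_inD s1 s2)).
have -> : (p + q) ^+ 2 = (1 + q / p) * p ^+ 2 + (1 + (q / p)^-1) * q ^+ 2.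
  by field; rewrite p0 q0.
rewrite {2}/p {3}/q (fock_norm_sqr s1) (fock_norm_sqr s2) !mulr_sumr -big_split.
by apply: ler_sum => I _; apply: sqmodD_le; rewrite divr_gt0.
Qed.

Lemma fock_normB phi psi : fock_vec phi -> fock_vec psi ->
  fock_norm (phi - psi) <= fock_norm phi + fock_norm psi.
Proof.
move=> f1 f2; rewrite -(fock_normN f2) fock_normD //.
by rewrite -scaleN1r; apply: fock_vecZ.
Qed.

Lemma sqmod_le_fock_norm phi I : fock_vec phi ->
  sqmod (phi I) <= fock_norm phi ^+ 2.
Proof.
move=> /fock_vecP[T s]; rewrite (fock_norm_sqr s).
have [IT|/s ->] := boolP (I \in T); last first.
  by rewrite /sqmod /= expr0n addr0 sumr_ge0 // => *; apply: sqmod_ge0.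
rewrite (bigD1_seq I) ?fset_uniq //= lerDl sumr_ge0 // => *; exact: sqmod_ge0.
Qed.

Lemma Re_le_fock_norm phi I : fock_vec phi ->
  `|complex.Re (phi I)| <= fock_norm phi.
Proof.
move=> fp; rewrite -(@ler_pXn2r _ 2) ?nnegrE ?fock_norm_ge0 // real_normK ?num_real //.
by apply: le_trans (sqmod_le_fock_norm I fp); rewrite /sqmod lerDl sqr_ge0.
Qed.

Lemma Im_le_fock_norm phi I : fock_vec phi ->
  `|complex.Im (phi I)| <= fock_norm phi.
Proof.
move=> fp; rewrite -(@ler_pXn2r _ 2) ?nnegrE ?fock_norm_ge0 // real_normK ?num_real //.
by apply: le_trans (sqmod_le_fock_norm I fp); rewrite /sqmod lerDr sqr_ge0.
Qed.

(** The common finite support T turns the squared norm into a finite sum, so amplitudewise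
    convergence is enough. *)
Lemma fock_norm_lim T (u : nat -> fock) phi (K : R) :
  (forall n, supp_in T (u n)) -> (forall n, fock_norm (u n) <= K) ->
  supp_in T phi ->
  (forall I, complex.Re (u n I) @[n --> \oo] --> complex.Re (phi I)) ->
  (forall I, complex.Im (u n I) @[n --> \oo] --> complex.Im (phi I)) ->
  fock_norm phi <= K.
Proof.
move=> su uK sp cR cI.
have K0 : 0 <= K by apply: le_trans (uK 0%N); apply: fock_norm_ge0.
rewrite -(@ler_pXn2r _ 2) ?nnegrE ?fock_norm_ge0 // (fock_norm_sqr sp).
have cv : (\sum_(I <- T) sqmod (u n I)) @[n --> \oo] -->
    \sum_(I <- T) sqmod (phi I).
  elim: (enum_fset T) => [|I s IHs].
    by under eq_fun do rewrite big_nil; rewrite big_nil; apply: cvg_cst.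
  under eq_fun do rewrite big_cons; rewrite big_cons; apply: cvgD => //.
  by rewrite /sqmod; under eq_fun do rewrite !expr2; rewrite !expr2;
    apply: cvgD; apply: cvgM.
rewrite -(cvg_lim _ cv) //; apply: limr_le; first by apply/cvg_ex; eexists; exact: cv.
near=> n; rewrite -(fock_norm_sqr (su n)).
by rewrite ler_pXn2r ?nnegrE ?fock_norm_ge0.
Unshelve. all: by end_near.
Qed.

End FockNorm.

(** * The exponential to second order *)

Section Exponential.
Variables (R : realType) (M : countType).
Notation fock := (fock R M).
Notation op := (op R M).
Implicit Types (phi psi : fock) (A B G : op) (F : {fset M}).

(** Bounds are carried in this form because [opnorm] is a [sup], which dominates the values of the
    operator only once they are known to be bounded. *)
Definition nbound (K : R) A : Prop := forall psi, fock_vec psi ->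
  fock_norm (A psi) <= K * fock_norm psi.

(* [A psi] at [I] only sees the configurations that agree with [I] off [F]. *)
Definition sat F A : Prop := forall psi I,
  (forall J, J `\` F = I `\` F -> psi J = 0) -> A psi I = 0.

(** Closure of T under changing the occupation of the modes in F. It is finite and, by [sat_hull],
    every operator satisfying [sat F] maps vectors supported in it to vectors supported in it. *)
Definition hull F (T : {fset {fset M}}) : {fset {fset M}} :=
  [fset (J `\` F) `|` X | J in T, X in fpowerset F].

Lemma in_hull F T I :
  reflect (exists2 J, J \in T & J `\` F = I `\` F) (I \in hull F T).
Proof.
apply: (iffP (imfset2P _ _ _ _ _)) => [[J JT [X XF ->]]|[J JT eJ]].
  exists J => //; move: XF; rewrite /= fpowersetE => /fsubsetP XF.
  apply/fsetP => j; rewrite !inE; case: (boolP (j \in F)) => //= jF.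
  by case: (boolP (j \in X)) => [/XF|]; rewrite ?(negPf jF) // orbF.
exists J => //; exists (I `&` F); first by rewrite /= fpowersetE fsubsetIr.
by rewrite eJ fsetUC fsetID.
Qed.

Lemma hull_sub F T : (T `<=` hull F T)%fset.
Proof. by apply/fsubsetP => I IT; apply/in_hull; exists I. Qed.

Lemma sat_hull F T A psi :
  sat F A -> supp_in (hull F T) psi -> supp_in (hull F T) (A psi).
Proof.
move=> sA sT I IT; apply: sA => J eJ; apply: sT.
by apply: contraNN IT => /in_hull[K KT eK]; apply/in_hull; exists K; rewrite // eK.
Qed.

Definition pres A : Prop := forall psi, fock_vec psi -> fock_vec (A psi).

Lemma presD A B : pres A -> pres B -> pres (A + B).
Proof. by move=> pA pB psi f; apply: fock_vecD; [apply: pA|apply: pB]. Qed.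

Lemma presZ a A : pres A -> pres (a *: A).
Proof. by move=> pA psi f; apply: fock_vecZ; apply: pA. Qed.

Lemma presB A B : pres A -> pres B -> pres (A - B).
Proof. by move=> pA pB; rewrite -scaleN1r; apply: presD => //; apply: presZ. Qed.

Lemma pres_comp A B : pres A -> pres B -> pres (A \o B).
Proof. by move=> pA pB psi f; apply: pA; apply: pB. Qed.

Lemma sat_fock_vec F A : sat F A -> pres A.
Proof.
move=> sA psi /fock_vecP[T sT]; apply/fock_vecP; exists (hull F T).
by apply: sat_hull => //; apply: supp_inW (hull_sub F T).
Qed.

Lemma sat_id F : sat F idfun.
Proof. by move=> psi I; apply. Qed.

Lemma sat_comp F A B : sat F A -> sat F B -> sat F (A \o B).
Proof.
move=> sA sB psi I p0; apply: sA => J eJ; apply: sB => K eK; apply: p0.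
by rewrite eK.
Qed.

Lemma satD F A B : sat F A -> sat F B -> sat F (A + B).
Proof. by move=> sA sB psi I p0; rewrite !fctE sA ?sB ?addr0. Qed.

Lemma satZ F a A : sat F A -> sat F (a *: A).
Proof. by move=> sA psi I p0; rewrite !fctE sA ?scaler0. Qed.

Lemma satW F F' A : (F `<=` F')%fset -> sat F A -> sat F' A.
Proof.
move=> /fsetUidPr FF' sA psi I p0; apply: sA => J eJ; apply: p0.
by rewrite -FF' -!fsetDDl eJ.
Qed.

Lemma nboundW K K' A : K <= K' -> nbound K A -> nbound K' A.
Proof.
move=> KK' bA psi f; apply: le_trans (bA psi f) _.
by rewrite ler_wpM2r ?fock_norm_ge0.
Qed.

Lemma nboundD K K' A B : pres A -> pres B ->
  nbound K A -> nbound K' B -> nbound (K + K') (A + B).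
Proof.
move=> pA pB bA bB psi f.
have /le_trans := fock_normD (pA _ f) (pB _ f); apply.
by rewrite mulrDl lerD ?bA ?bB.
Qed.

Lemma nboundZ K a c A : pres A -> 0 <= c -> sqmod a = c ^+ 2 ->
  nbound K A -> nbound (c * K) (a *: A).
Proof.
move=> pA c0 ac bA psi f; rewrite (fock_normZ_eq _ c0 ac); last exact: pA.
by rewrite -mulrA ler_wpM2l ?bA.
Qed.

Lemma nboundB K K' A B : pres A -> pres B ->
  nbound K A -> nbound K' B -> nbound (K + K') (A - B).
Proof.
move=> pA pB bA bB psi f.
have /le_trans := fock_normB (pA _ f) (pB _ f); apply.
by rewrite mulrDl lerD ?bA ?bB.
Qed.

Definition expterm G psi (k : nat) : fock := (k`!%:R : R[i])^-1 *: iter k G psi.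

Lemma sat_iter F G k : sat F G -> sat F (iter k G).
Proof.
move=> sG; elim: k => [|k IHk]; first exact: sat_id.
exact: sat_comp.
Qed.

Lemma sat_expterm F G k : sat F G -> sat F (expterm G ^~ k).
Proof. by move=> sG; apply: satZ; apply: sat_iter. Qed.

Lemma iter_norm F G g k psi : sat F G -> nbound g G -> 0 <= g ->
  fock_vec psi -> fock_norm (iter k G psi) <= g ^+ k * fock_norm psi.
Proof.
move=> sG bG g0 f; elim: k => [|k IHk]; first by rewrite mul1r.
apply: le_trans (bG _ (sat_fock_vec (sat_iter k sG) f)) _.
by rewrite exprS -mulrA ler_wpM2l.
Qed.

(** The factor 1/k! is only bounded by 1: a geometric series suffices, since small times alone
    matter and there g is at most 1/2. *)
Lemma expterm_norm F G g k psi : sat F G -> nbound g G -> 0 <= g ->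
  fock_vec psi -> fock_norm (expterm G psi k) <= g ^+ k * fock_norm psi.
Proof.
move=> sG bG g0 f.
have fi := sat_fock_vec (sat_iter k sG) f.
rewrite /expterm (@fock_normZ_eq _ _ _ (k`!%:R)^-1) ?invr_ge0 //; last first.
  have -> : (k`!%:R : R[i])^-1 = ((k`!%:R : R)^-1)%:C.
    by rewrite fmorphV rmorph_nat.
  by rewrite /sqmod /= expr0n addr0.
apply: le_trans (iter_norm k sG bG g0 f).
by rewrite ler_piMl ?fock_norm_ge0 // invf_le1 ?ltr0n ?fact_gt0 // ler1n fact_gt0.
Qed.

Lemma expop_sumE G psi n :
  (expop_sum G psi)^~ n = \sum_(0 <= k < n) expterm G psi k.
Proof.
by apply/funext => I; rewrite /expop_sum big_mkord fct_sumE.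
Qed.

Lemma geom_le2 (g : R) n : 0 <= g <= 2^-1 -> \sum_(k < n) g ^+ k <= 2.
Proof.
move=> /andP[g0 g2]; elim: n => [|n IHn]; first by rewrite big_ord0.
rewrite big_ord_recl expr0; under eq_bigr do rewrite exprS.
rewrite -mulr_sumr; apply: (@le_trans _ _ (1 + 2^-1 * 2)); last by lra.
by rewrite lerD2l ler_pM // sumr_ge0 // => *; apply: exprn_ge0.
Qed.

(** The additive f stands for the real or the imaginary part at I, whose limits [expop] takes
    separately; both series are dominated by the same geometric one. *)
Lemma cvg_expop (f : {additive R[i] -> R}) F G g psi I :
  (forall phi, fock_vec phi -> `|f (phi I)| <= fock_norm phi) ->
  sat F G -> nbound g G -> 0 <= g <= 2^-1 -> fock_vec psi ->
  cvgn (fun n => f (expop_sum G psi I n)).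
Proof.
move=> fle sG bG g02 fp; have /andP[g0 g2] := g02.
have -> : (fun n => f (expop_sum G psi I n)) =
    series (fun k => f (expterm G psi k I)).
  apply/funext => n; rewrite -[expop_sum _ _ _ _]/((expop_sum G psi)^~ n I).
  by rewrite expop_sumE fct_sumE raddf_sum.
apply: normed_cvg; apply: (@series_le_cvg _ _ (geometric (fock_norm psi) g)).
- by move=> n /=.
- by move=> n; apply: geometric_ge0; rewrite ?fock_norm_ge0.
- move=> n /=; rewrite mulrC; apply: le_trans (expterm_norm n sG bG g0 fp).
  by apply: fle; apply: (sat_fock_vec (sat_expterm n sG)).
apply: is_cvg_geometric_series; rewrite ger0_norm //; lra.
Qed.

Lemma sat_expop_sum F G n :
  sat F G -> sat F (fun psi => (expop_sum G psi)^~ n).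
Proof.
move=> sG psi I p0; rewrite /expop_sum big1 // => k _.
by rewrite (sat_iter k sG) ?mulr0.
Qed.

Lemma sat_expop F G : sat F G -> sat F (expop G).
Proof.
move=> sG psi I p0; rewrite /expop.
have -> : expop_sum G psi I = fun=> 0.
  by apply/funext => n; apply: (sat_expop_sum n sG).
by rewrite /= lim_cst.
Qed.

Lemma expop_remainder F G g psi :
  sat F G -> nbound g G -> 0 <= g <= 2^-1 -> fock_vec psi ->
  fock_norm (expop G psi - psi - G psi) <= 2 * g ^+ 2 * fock_norm psi.
Proof.
move=> sG bG g02 fp; have /andP[g0 g2] := g02.
have [T sT] := (fock_vecP psi).1 fp.
have sH := supp_inW sT (hull_sub F T).
have sGH := sat_hull sG sH.
have sub u v : supp_in (hull F T) u -> supp_in (hull F T) v ->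
    supp_in (hull F T) (u - v).
  by move=> su sv; apply: supp_inD => //; rewrite -scaleN1r; apply: supp_inZ.
(* The Taylor tail, with indices shifted by 2: n of its terms are n + 2 terms of the exponential
   series less the first two, which are psi and G psi. *)
pose u n := \sum_(k < n) expterm G psi k.+2.
have uE n : u n = (expop_sum G psi)^~ n.+2 - psi - G psi.
  rewrite expop_sumE big_mkord !big_ord_recl /= /expterm /= fact0 invr1 !scale1r.
  by rewrite -[RHS]addrA -opprD addrA [RHS]addrC addKr.
apply: (@fock_norm_lim _ _ (hull F T) u).
- by move=> n; rewrite uE; do 2 apply: (sub _ _) => //; apply: (sat_hull (sat_expop_sum _ sG)).
- move=> n; have : fock_vec (u n) /\
      fock_norm (u n) <= \sum_(k < n) g ^+ k.+2 * fock_norm psi.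
    rewrite /u; elim: n => [|n [IH1 IH2]].
      by rewrite !big_ord0 fock_norm0; split=> //; apply: fock_vec0.
    rewrite !big_ord_recr /=.
    have ft : fock_vec (expterm G psi n.+2) by apply: (sat_fock_vec (sat_expterm _ sG)).
    split; first exact: fock_vecD.
    apply: le_trans (fock_normD IH1 ft) _; rewrite lerD //.
    exact: (expterm_norm n.+2 sG bG g0 fp).
  case=> _ /le_trans; apply; rewrite -mulr_suml ler_wpM2r ?fock_norm_ge0 //.
  under eq_bigr do rewrite -addn2 exprD.
  by rewrite -mulr_suml ler_wpM2r ?exprn_ge0 // geom_le2.
- by do 2 apply: (sub _ _) => //; apply: (sat_hull (sat_expop sG)).
- move=> I; under eq_fun do rewrite uE !fctE !raddfB /=.
  rewrite !fctE !raddfB /=; do 2 (apply: cvgB; last exact: cvg_cst).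
  rewrite (cvg_shiftS (fun n => complex.Re (expop_sum G psi I n.+1)))
    (cvg_shiftS (fun n => complex.Re (expop_sum G psi I n))).
  exact: (cvg_expop (fun phi => @Re_le_fock_norm R M phi I) sG bG g02 fp).
- move=> I; under eq_fun do rewrite uE !fctE !raddfB /=.
  rewrite !fctE !raddfB /=; do 2 (apply: cvgB; last exact: cvg_cst).
  rewrite (cvg_shiftS (fun n => complex.Im (expop_sum G psi I n.+1)))
    (cvg_shiftS (fun n => complex.Im (expop_sum G psi I n))).
  exact: (cvg_expop (fun phi => @Im_le_fock_norm R M phi I) sG bG g02 fp).
Qed.

End Exponential.

(** * Majorana operators *)

Section Majorana.
Variables (R : realType) (M : countType).
Notation fock := (fock R M).
Notation op := (op R M).
Notation letter := (letter M).
Implicit Types (phi psi : fock) (A B : op) (P : pred letter) (c l : letter).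

(** An [op] is an arbitrary map, so linearity has to be carried along as a property. *)
Definition lin A : Prop :=
  forall a phi psi, A (a *: phi + psi) = a *: A phi + A psi.

Section Lin.
Variables (A : op) (linA : lin A).
Lemma lin0 : A 0 = 0.
Proof. by have := linA (-1) 0 0; rewrite scaler0 addr0 scaleN1r addNr. Qed.
Lemma linD phi psi : A (phi + psi) = A phi + A psi.
Proof. by rewrite -[phi]scale1r linA !scale1r. Qed.
Lemma linZ a phi : A (a *: phi) = a *: A phi.
Proof. by rewrite -[a *: phi]addr0 linA lin0 addr0. Qed.
Lemma linN phi : A (- phi) = - A phi.
Proof. by rewrite -scaleN1r linZ scaleN1r. Qed.
Lemma linB phi psi : A (phi - psi) = A phi - A psi.
Proof. by rewrite linD linN. Qed.
End Lin.

Lemma lin_comp A B : lin A -> lin B -> lin (A \o B).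
Proof. by move=> lA lB a u v; rewrite /= lB lA. Qed.

Lemma opDE A B phi : (A + B) phi = A phi + B phi. Proof. by []. Qed.
Lemma opBE A B phi : (A - B) phi = A phi - B phi. Proof. by []. Qed.
Lemma opZE a A phi : (a *: A) phi = a *: A phi. Proof. by []. Qed.
Lemma opNE A phi : (- A) phi = - A phi. Proof. by []. Qed.
Definition opE := (opDE, opBE, opZE, opNE).

Lemma lin_op0 : lin 0.
Proof. by move=> a u v; rewrite -[RHS]/(a *: (0 : fock) + 0) scaler0 addr0. Qed.

Lemma lin_add A B : lin A -> lin B -> lin (A + B).
Proof. by move=> lA lB a u v; rewrite !opE lA lB scalerDr addrACA. Qed.

Lemma lin_scale b A : lin A -> lin (b *: A).
Proof. by move=> lA a u v; rewrite !opE lA scalerDr !scalerA mulrC. Qed.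

Lemma lin_annih m : lin (annih m).
Proof.
move=> a u v; apply/funext => I; rewrite /annih !fctE.
by case: ifP => _; rewrite ?scaler0 ?addr0 // mulrDr /GRing.scale /= mulrCA.
Qed.

Lemma lin_creat m : lin (creat m).
Proof.
move=> a u v; apply/funext => I; rewrite /creat !fctE.
by case: ifP => _; rewrite ?scaler0 ?addr0 // mulrDr /GRing.scale /= mulrCA.
Qed.

Lemma lin_ladder l : lin (ladder l).
Proof. by rewrite /ladder; case: l.1; [apply: lin_creat|apply: lin_annih]. Qed.

(** The Boolean of a letter, which tells creation from annihilation in [ladder], selects here one of
    the two Majorana operators of the mode; words in both alphabets thus share one type. *)
Definition maj c : op :=
  if c.1 then creat c.2 + annih c.2 else 'i%C *: (creat c.2 - annih c.2).

Lemma lin_maj c : lin (maj c).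
Proof.
case: c => [[] m].
  exact: lin_add (lin_creat m) (lin_annih m).
have := lin_scale 'i%C (lin_add (lin_creat m) (lin_scale (-1) (lin_annih m))).
by rewrite scaleN1r.
Qed.

Lemma complexI_sqr : 'i%C * 'i%C = -1 :> R[i].
Proof. by rewrite -expr2 sqr_i. Qed.

Lemma annih_creat m n psi :
  annih m (creat n psi) = (m == n)%:R *: psi - creat n (annih m psi).
Proof.
by apply/funext => I; apply/eqP; rewrite !fctE eq_sym subr_eq eq_sym car_annih_creat.
Qed.

Lemma annih_annih m n psi : annih m (annih n psi) = - annih n (annih m psi).
Proof. by apply/funext => I; apply/eqP; rewrite !fctE -addr_eq0 car_annih. Qed.

Lemma creat_creat m n psi : creat m (creat n psi) = - creat n (creat m psi).
Proof. by apply/funext => I; apply/eqP; rewrite !fctE -addr_eq0 car_creat. Qed.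

(** The Clifford relations. For two operators of the second kind the prefactor i^2 = -1 cancels the
    minus sign of the mixed anticommutators. *)
Lemma maj_anticomm c d psi :
  maj c (maj d psi) + maj d (maj c psi) = (c == d)%:R *: psi *+ 2.
Proof.
case: c d => [b m] [b' n]; rewrite mulr2n /maj /= xpair_eqE.
have LA := lin_annih; have LC := lin_creat.
have ac := annih_creat m n psi; have ca := annih_creat n m psi.
have aa := annih_annih m n psi; have cc := creat_creat m n psi.
case: b b' => [] [] /=;
  rewrite !(opE, linZ (LA _), linZ (LC _), linD (LA _), linD (LC _), linN (LA _),
    linN (LC _)) ?ac ?ca ?aa ?cc;
  apply/funext => I; rewrite !fctE ?[n == m]eq_sym /GRing.scale /=.
- by ring.
- by ring.
- by ring.
- by have i2 := complexI_sqr; ring: i2.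
Qed.

Lemma maj_sqr c psi : maj c (maj c psi) = psi.
Proof.
have := maj_anticomm c c psi.
rewrite eqxx scale1r -mulr2n => e; apply/funext => I.
apply: (@mulIf R[i] 2); first by rewrite pnatr_eq0.
have := congr1 (fun phi : fock => phi I) e.
by rewrite /= !mulr2n !fctE !mulrDr !mulr1.
Qed.

Lemma maj_anti c d psi : c != d -> maj c (maj d psi) = - maj d (maj c psi).
Proof.
move=> cd; apply/eqP; rewrite -addr_eq0 maj_anticomm (negPf cd).
by rewrite scale0r mul0rn.
Qed.
End Majorana.

(** * Spans of words and averages over Majorana conjugations *)

Section Span.
Variables (R : realType) (M : countType).
Notation fock := (fock R M).
Notation op := (op R M).
Notation letter := (letter M).
Notation maj := (@maj R M).
Notation ladder := (@ladder R M).
Implicit Types (phi psi : fock) (A B : op) (P : pred letter) (c l : letter)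
  (gen : letter -> op) (w : seq letter).

Definition word gen w : op := foldr (fun l A => gen l \o A) idfun w.

(** Span of the words of parity b with letters in P. The alphabet [gen] is a parameter, so that the
    ladder words defining [even_alg] and Majorana words are handled together. *)
Inductive gspan gen P (b : bool) : op -> Prop :=
| gspan0 : gspan gen P b 0
| gspanD A B : gspan gen P b A -> gspan gen P b B -> gspan gen P b (A + B)
| gspanZ a A : gspan gen P b A -> gspan gen P b (a *: A)
| gspan_word w : all P w -> odd (size w) = b -> gspan gen P b (word gen w).

Lemma gspanW gen P P' b A : {subset P <= P'} -> gspan gen P b A -> gspan gen P' b A.
Proof.
move=> PP'; elim=> *; [exact: gspan0|exact: gspanD|exact: gspanZ|].
by apply: gspan_word => //; apply: sub_all PP' _ _.
Qed.

Lemma gspanB gen P b A B : gspan gen P b A -> gspan gen P b B -> gspan gen P b (A - B).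
Proof. by move=> sA sB; rewrite -scaleN1r; apply: gspanD => //; apply: gspanZ. Qed.

Lemma lin_word gen w : (forall l, lin (gen l)) -> lin (word gen w).
Proof. by move=> lg; elim: w => //= l w IH; apply: lin_comp. Qed.

Lemma gspan_lin gen P b A : (forall l, lin (gen l)) -> gspan gen P b A -> lin A.
Proof.
move=> lg; elim=> [|||w _ _].
- exact: lin_op0.
- by move=> *; apply: lin_add.
- by move=> *; apply: lin_scale.
- exact: lin_word.
Qed.

Lemma comp_addr A B B' : lin A -> A \o (B + B') = (A \o B) + (A \o B').
Proof.
by move=> lA; apply/funext => u; rewrite -[LHS]/(A (B u + B' u)) (linD lA).
Qed.

Lemma comp_scaler a A B : lin A -> A \o (a *: B) = a *: (A \o B).
Proof. by move=> lA; apply/funext => u; rewrite -[LHS]/(A (a *: B u)) (linZ lA). Qed.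

Lemma gspan_gen gen P b A l : (forall l, lin (gen l)) -> P l ->
  gspan gen P b A -> gspan gen P (~~ b) (gen l \o A).
Proof.
move=> lg Pl; elim=> [|B C _ IB _ IC|a B _ IB|w Pw <-].
- rewrite (_ : _ \o _ = 0); first exact: gspan0.
  by apply/funext => u /=; rewrite (lin0 (lg l)).
- by rewrite comp_addr //; apply: gspanD.
- by rewrite comp_scaler //; apply: gspanZ.
- by apply: (@gspan_word gen P _ (l :: w)); rewrite //= Pl.
Qed.

(** Change of alphabet: expanding each letter into two letters of the new alphabet keeps the length
    of every word, hence its parity. *)
Lemma gspan_trans gen gen' P b A : (forall l, lin (gen' l)) ->
  (forall l, P l -> exists a1 a2 l1 l2,
    [/\ P l1, P l2 & gen l = a1 *: gen' l1 + a2 *: gen' l2]) ->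
  gspan gen P b A -> gspan gen' P b A.
Proof.
move=> lg gg'; elim=> [|B C _ IB _ IC|a B _ IB|w Pw <-].
- exact: gspan0.
- exact: gspanD.
- exact: gspanZ.
elim: w Pw => [_|l w IH /= /andP[/gg'[a1 [a2 [l1 [l2 [P1 P2 ->]]]]] /IH Iw]].
  exact: (@gspan_word gen' P _ [::]).
rewrite (_ : _ \o _ = a1 *: (gen' l1 \o word gen w) + a2 *: (gen' l2 \o word gen w)) //.
by apply: gspanD; apply: gspanZ; apply: gspan_gen.
Qed.

Lemma ladder_maj l : exists a1 a2 l1 l2, [/\ l1.2 = l.2, l2.2 = l.2 &
  ladder l = a1 *: maj l1 + a2 *: maj l2].
Proof.
case: l => b m; exists 2^-1, (if b then - 'i%C / 2 else 'i%C / 2), (true, m), (false, m).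
split=> //; apply/funext => psi; apply/funext => I.
rewrite !opE /ladder /maj /= !opE !fctE /GRing.scale /=.
have i2 := complexI_sqr R.
by case: b => /=; field: i2.
Qed.

Lemma maj_ladder l : exists a1 a2 l1 l2, [/\ l1.2 = l.2, l2.2 = l.2 &
  maj l = a1 *: ladder l1 + a2 *: ladder l2].
Proof.
case: l => b m; exists (if b then 1 else 'i%C), (if b then 1 else - 'i%C), (true, m), (false, m).
split=> //; apply/funext => psi; apply/funext => I.
by rewrite !opE /ladder /maj; case: b; rewrite /= !opE !fctE /GRing.scale /=; ring.
Qed.

Lemma even_alg_ladder (X : pred M) A :
  even_alg X A <-> gspan ladder (fun l => X l.2) false A.
Proof.
split=> [[s + ->]|].
  elim: s => [_|[a w] s IHs /= /andP[/andP[ow /negPf ew] /IHs sA]].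
    rewrite (_ : lincomb _ = 0); first exact: gspan0.
    by apply/funext => psi; apply/funext => I; rewrite /lincomb big_nil.
  rewrite (_ : lincomb _ = a *: word ladder w + lincomb s).
    by apply: gspanD => //; apply: gspanZ; apply: gspan_word.
  by apply/funext => psi; apply/funext => I; rewrite /lincomb big_cons.
elim=> [|B C _ [s1 a1 e1] _ [s2 a2 e2]|a B _ [s1 a1 e1]|w Pw ew].
- exists [::] => //.
  by apply/funext => psi; apply/funext => I; rewrite /lincomb big_nil.
- exists (s1 ++ s2); first by rewrite all_cat a1.
  apply/funext => psi; apply/funext => I.
  by rewrite opE e1 e2 /lincomb big_cat.
- exists [seq (a * p.1, p.2) | p <- s1]; first by rewrite all_map.
  apply/funext => psi; apply/funext => I.
  rewrite opE e1 -[LHS]/(a * lincomb s1 psi I) /lincomb big_map mulr_sumr.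
  by apply: eq_bigr => p _; rewrite mulrA.
- exists [:: (1, w)]; first by rewrite /= ew !andbT.
  by apply/funext => psi; apply/funext => I; rewrite /lincomb big_seq1 mul1r.
Qed.

Lemma even_algP (X : pred M) A :
  even_alg X A <-> gspan maj (fun l => X l.2) false A.
Proof.
split=> [/even_alg_ladder|sA]; last (apply/even_alg_ladder; move: sA).
  apply: gspan_trans => [|l Xl]; first exact: lin_maj.
  have [a1 [a2 [l1 [l2 [e1 e2 e]]]]] := ladder_maj l.
  by exists a1, a2, l1, l2; rewrite e1 e2.
apply: gspan_trans => [|l Xl]; first exact: lin_ladder.
have [a1 [a2 [l1 [l2 [e1 e2 e]]]]] := maj_ladder l.
by exists a1, a2, l1, l2; rewrite e1 e2.
Qed.

(** * Commutation and conjugation of Majorana words *)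

Notation mword := (word maj).
Notation mspan := (gspan maj).

Lemma lin_mword w : lin (mword w).
Proof. by apply: lin_word; apply: lin_maj. Qed.

Lemma mword_comm c w psi : c \notin w ->
  maj c (mword w psi) = (-1) ^+ size w *: mword w (maj c psi).
Proof.
elim: w => [_|l w IH]; first by rewrite scale1r.
rewrite inE negb_or => /andP[cl cw] /=.
by rewrite maj_anti // IH // (linZ (lin_maj l)) exprS mulN1r scaleNr.
Qed.

(** Each letter of w' passes through w at the cost of (-1)^|w| = 1, so w' may have either parity. *)
Lemma mword_even_comm w w' psi : ~~ odd (size w) -> {in w', forall c, c \notin w} ->
  mword w' (mword w psi) = mword w (mword w' psi).
Proof.
move=> ew; elim: w' => //= c w' IH dw.
rewrite IH; last by move=> d dw'; apply: dw; rewrite inE dw' orbT.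
by rewrite mword_comm ?dw ?mem_head // -signr_odd (negPf ew) scale1r.
Qed.

(** Letters are involutions, so the reversed word is an inverse. *)
Lemma mword_rev w psi : mword w (mword (rev w) psi) = psi.
Proof.
elim: w psi => //= l w IH psi; rewrite rev_cons -cats1.
have -> : mword (rev w ++ [:: l]) psi = mword (rev w) (maj l psi).
  by elim: (rev w) => //= d v ->.
by rewrite IH maj_sqr.
Qed.

Definition cj c A : op := maj c \o A \o maj c.

Lemma cjD c A B : cj c (A + B) = cj c A + cj c B.
Proof.
apply/funext => u; rewrite -[LHS]/(maj c (A (maj c u) + B (maj c u))).
by rewrite (linD (lin_maj c)).
Qed.

Lemma cjZ c a A : cj c (a *: A) = a *: cj c A.
Proof.
apply/funext => u; rewrite -[LHS]/(maj c (a *: A (maj c u))).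
by rewrite (linZ (lin_maj c)).
Qed.

Lemma cj0 c : cj c 0 = 0.
Proof. by apply/funext => u; apply: (lin0 (lin_maj c)). Qed.

Lemma lin_cj c A : lin A -> lin (cj c A).
Proof. by move=> lA; exact: lin_comp (lin_comp (lin_maj c) lA) (lin_maj c). Qed.

(** Exchanging c and d costs one sign on each side of A; linearity lets the two signs cancel. *)
Lemma cj_comm c d A : lin A -> cj c (cj d A) = cj d (cj c A).
Proof.
move=> lA; have [->//|cd] := eqVneq c d.
apply/funext => u; rewrite /cj /= maj_anti // [maj d (maj c u)]maj_anti 1?eq_sym //.
by rewrite (linN lA) !(linN (lin_maj _)) opprK.
Qed.

(** Moving c through the word gives a sign for every letter other than c. For an even word the total
    sign is the parity of the number of occurrences of c, which is what the averages detect. *)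
Lemma cj_mword c w :
  cj c (mword w) = (-1) ^+ (size w + count_mem c w) *: mword w.
Proof.
apply/funext => psi; rewrite opZE /cj /=.
elim: w psi => [|l w IH] psi /=; first by rewrite scale1r maj_sqr.
have [->|lc] := eqVneq l c.
  rewrite maj_sqr -[mword w _](maj_sqr c) IH (linZ (lin_maj c)).
  by rewrite add1n addSn addnS !exprS !mulN1r opprK.
by rewrite maj_anti 1?eq_sym // IH (linZ (lin_maj l)) add0n addSn exprS mulN1r scaleNr.
Qed.

Lemma mspan_cj c P b A : mspan P b A -> mspan P b (cj c A).
Proof.
elim=> [|B C _ IB _ IC|a B _ IB|w Pw ew].
- by rewrite cj0; apply: gspan0.
- by rewrite cjD; apply: gspanD.
- by rewrite cjZ; apply: gspanZ.
- by rewrite cj_mword; apply: gspanZ; apply: gspan_word.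
Qed.

Lemma cj_id c P A : ~~ P c -> mspan P false A -> cj c A = A.
Proof.
move=> Pc; elim=> [|B C _ IB _ IC|a B _ IB|w Pw ew].
- exact: cj0.
- by rewrite cjD IB IC.
- by rewrite cjZ IB.
rewrite cj_mword (count_memPn _) ?addn0; last first.
  by apply: contra Pc => cw; apply: (allP Pw).
by rewrite -signr_odd ew scale1r.
Qed.

(** * Averages over conjugations *)

Definition twirl c A : op := 2^-1 *: (A + cj c A).

Lemma half2 A : 2^-1 *: (A + A) = A.
Proof.
by rewrite -{1 2}[A]scale1r -scalerDl -mulr2n scalerA mulVf ?pnatr_eq0 // scale1r.
Qed.

Lemma twirlD c A B : twirl c (A + B) = twirl c A + twirl c B.
Proof. by rewrite /twirl cjD addrACA scalerDr. Qed.
Lemma twirlZ c a A : twirl c (a *: A) = a *: twirl c A.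
Proof. by rewrite /twirl cjZ -scalerDr !scalerA mulrC. Qed.
Lemma twirlB c A B : twirl c (A - B) = twirl c A - twirl c B.
Proof. by rewrite -scaleN1r twirlD twirlZ scaleN1r. Qed.
Lemma twirl0 c : twirl c 0 = 0.
Proof. by rewrite /twirl cj0 addr0 scaler0. Qed.

Lemma lin_twirl c A : lin A -> lin (twirl c A).
Proof. by move=> lA; apply: lin_scale; apply: lin_add => //; apply: lin_cj. Qed.

Lemma twirl_comm c d A : lin A -> twirl c (twirl d A) = twirl d (twirl c A).
Proof.
move=> lA; rewrite /twirl !cjZ !cjD cj_comm // -!scalerDr.
by rewrite addrACA.
Qed.

Lemma twirl_id c P A : ~~ P c -> mspan P false A -> twirl c A = A.
Proof. by move=> Pc sA; rewrite /twirl (cj_id Pc sA) half2. Qed.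

(** A word with evenly many c still displays the letter c. Here all occurrences are brought to the
    front, signs going into the coefficient, and cancel in pairs. *)
Lemma mword_filter c w : exists a : R[i], mword w =
  a *: ((if odd (count_mem c w) then maj c else idfun) \o
        mword [seq l <- w | l != c]).
Proof.
elim: w => [|l w [a IH]] /=.
  by exists 1; apply/funext => u; rewrite opE scale1r.
have [->|lc] /= := eqVneq l c.
  exists a; apply/funext => u; rewrite /= IH !opE (linZ (lin_maj c)) /=.
  by case: (odd _); rewrite //= maj_sqr.
exists (if odd (count_mem c w) then - a else a).
apply/funext => u; rewrite /= IH !opE (linZ (lin_maj l)) /= add0n.
by case: (odd _) => //; rewrite maj_anti // scalerN scaleNr.
Qed.

Lemma mspan_twirl c P A : mspan P false A ->
  mspan [pred l | (l != c) && P l] false (twirl c A).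
Proof.
elim=> [|B C _ IB _ IC|a B _ IB|w Pw ew].
- by rewrite twirl0; apply: gspan0.
- by rewrite twirlD; apply: gspanD.
- by rewrite twirlZ; apply: gspanZ.
rewrite /twirl cj_mword -signr_odd oddD ew /=.
have [a] := mword_filter c w; case: (boolP (odd (count_mem c w))) => oc e.
  by rewrite scaleN1r subrr scaler0; apply: gspan0.
rewrite expr0 scale1r half2 e; apply: gspanZ; apply: gspan_word.
  by rewrite all_filter; apply: sub_all Pw => l Pl; apply/implyP => lc; rewrite /= lc.
(* Evenly many letters were deleted from an even word, so what is left is even. *)
rewrite size_filter; have := count_predC (pred1 c) w => /(congr1 odd).
by rewrite oddD (negPf oc) ew.
Qed.

Definition twirls cs A : op := foldr twirl A cs.

Lemma twirlsD cs A B : twirls cs (A + B) = twirls cs A + twirls cs B.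
Proof. by elim: cs => //= c cs ->; rewrite twirlD. Qed.
Lemma twirlsZ cs a A : twirls cs (a *: A) = a *: twirls cs A.
Proof. by elim: cs => //= c cs ->; rewrite twirlZ. Qed.
Lemma twirlsB cs A B : twirls cs (A - B) = twirls cs A - twirls cs B.
Proof. by elim: cs => //= c cs ->; rewrite twirlB. Qed.
Lemma twirls0 cs : twirls cs 0 = 0.
Proof. by elim: cs => //= c cs ->; rewrite twirl0. Qed.

Lemma lin_twirls cs A : lin A -> lin (twirls cs A).
Proof. by move=> lA; elim: cs => //= c cs IH; apply: lin_twirl. Qed.

Lemma twirl_twirls c cs A : lin A -> twirl c (twirls cs A) = twirls cs (twirl c A).
Proof.
by move=> lA; elim: cs => //= d cs IH; rewrite twirl_comm ?IH //; apply: lin_twirls.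
Qed.

Lemma twirls_comm cs ds A : lin A -> twirls cs (twirls ds A) = twirls ds (twirls cs A).
Proof.
move=> lA; elim: cs => //= c cs ->; rewrite twirl_twirls //; exact: lin_twirls.
Qed.

Lemma mspan_twirls cs P A : mspan P false A ->
  mspan [pred l | (l \notin cs) && P l] false (twirls cs A).
Proof.
move=> sA; elim: cs => [|c cs IH]; first by apply: gspanW sA => l.
apply: gspanW (mspan_twirl c IH) => l; rewrite !inE negb_or.
by rewrite andbA.
Qed.

Lemma twirls_id cs P A : {in cs, forall c, ~~ P c} -> mspan P false A ->
  twirls cs A = A.
Proof.
move=> csP sA; elim: cs csP => //= c cs IH csP.
rewrite IH; last by move=> d dcs; apply: csP; rewrite inE dcs orbT.
by apply: twirl_id sA; apply: csP; apply: mem_head.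
Qed.

Definition cjs w A : op := foldr cj A w.

Lemma cjsE w A : cjs w A = mword w \o A \o mword (rev w).
Proof.
elim: w => //= c w ->; rewrite rev_cons -cats1; apply/funext => u; rewrite /cj /=.
congr (maj c (mword w (A _))).
by elim: (rev w) => //= d v ->.
Qed.

Lemma mspan_cjs w P b A : mspan P b A -> mspan P b (cjs w A).
Proof. by move=> sA; elim: w => //= c w; apply: mspan_cj. Qed.

(* [twirls cs A] is a convex combination of the conjugates of [A] by words. *)
Lemma twirls_convex (Q : op -> Prop) cs A : lin A ->
  (forall B C, Q B -> Q C -> Q (2^-1 *: (B + C))) ->
  (forall w, {subset w <= cs} -> Q (cjs w A)) -> Q (twirls cs A).
Proof.
move=> + Qc; elim: cs A => [|c cs IH] A lA Qw; first exact: (Qw [::]).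
(* The outer average is moved innermost, so that the induction hypothesis applies to A and to its
   conjugate by c with the same list [cs]. *)
rewrite /= twirl_twirls // /twirl twirlsZ twirlsD; apply: Qc; apply: IH => //.
- by move=> w ws; apply: Qw => l /ws lcs; rewrite inE lcs orbT.
- exact: lin_cj.
move=> w ws; have -> : cjs w (cj c A) = cjs (rcons w c) A.
  by rewrite /cjs foldr_rcons.
apply: Qw => l; rewrite mem_rcons !inE => /orP[->//|/ws ->].
by rewrite orbT.
Qed.

End Span.

(** * Operator norms and adjoints *)

Section OpNorm.
Variables (R : realType) (M : countType).
Notation fock := (fock R M).
Notation op := (op R M).
Notation letter := (letter M).
Notation maj := (@maj R M).
Notation mword := (word maj).
Implicit Types (phi psi : fock) (A B H : op) (P : pred letter) (c l : letter)
  (F : {fset M}) (w : seq letter).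

Lemma inner_conj phi psi : fock_vec phi -> inner phi psi = (inner psi phi)^*%C.
Proof.
move=> /fock_vecP[T sT].
rewrite (innerE (or_introl sT)) (innerE (or_intror sT)) rmorph_sum.
by apply: eq_bigr => I _; rewrite rmorphM /= conjcK mulrC.
Qed.

Lemma sat_annih F m : m \in F -> sat F (@annih R M m).
Proof.
move=> mF psi I p0; rewrite /annih; case: ifP => // mI.
rewrite p0 ?mulr0 //; apply/fsetP => j; rewrite !inE.
by have [->|//] := eqVneq j m; rewrite mF.
Qed.

Lemma sat_creat F m : m \in F -> sat F (@creat R M m).
Proof.
move=> mF psi I p0; rewrite /creat; case: ifP => // mI.
rewrite p0 ?mulr0 //; apply/fsetP => j; rewrite !inE.
by have [->|//] := eqVneq j m; rewrite mF.
Qed.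

Lemma sat_maj F c : c.2 \in F -> sat F (maj c).
Proof.
case: c => [[] m] /= mF; first exact: satD (sat_creat mF) (sat_annih mF).
have := satZ 'i%C (satD (sat_creat mF) (satZ (-1) (sat_annih mF))).
by rewrite scaleN1r.
Qed.

Lemma pres_maj c : pres (maj c).
Proof. by apply: (@sat_fock_vec _ _ [fset c.2]); apply: sat_maj; rewrite inE. Qed.

Definition adjoint A B : Prop := forall phi psi, fock_vec phi -> fock_vec psi ->
  inner phi (A psi) = inner (B phi) psi.

Lemma adjointD A A' B B' : pres A -> pres A' -> pres B -> pres B' ->
  adjoint A A' -> adjoint B B' -> adjoint (A + B) (A' + B').
Proof.
move=> pA pA' pB pB' aA aB phi psi fp fq.
rewrite !opE innerDr; [|exact: pA|exact: pB].
rewrite innerDl; [|exact: pA'|exact: pB'].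
by rewrite aA // aB.
Qed.

Lemma adjointZ a A A' : pres A -> pres A' ->
  adjoint A A' -> adjoint (a *: A) (a^*%C *: A').
Proof.
move=> pA pA' aA phi psi fp fq.
rewrite !opE innerZr; last exact: pA.
rewrite innerZl; last exact: pA'.
by rewrite conjcK aA.
Qed.

Lemma adjoint_creat m : adjoint (creat m) (annih m).
Proof.
move=> phi psi fp fq; rewrite inner_conj // -creat_adjoint -inner_conj //.
exact: (sat_fock_vec (sat_annih (fset11 m))).
Qed.

Lemma selfadjoint_maj c : selfadjoint (maj c).
Proof.
case: c => b m.
have pa : pres (@annih R M m) by apply: sat_fock_vec (sat_annih (fset11 m)).
have pc : pres (@creat R M m) by apply: sat_fock_vec (sat_creat (fset11 m)).
have aa : adjoint (@annih R M m) (creat m) by move=> phi psi _ _; apply: creat_adjoint.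
have ac := @adjoint_creat m; have pNa := presZ (-1) pa; have pNc := presZ (-1) pc.
case: b.
  by have := adjointD pc pa pa pc ac aa; rewrite [annih m + _]addrC.
have aNa := adjointZ (-1) pa pc aa.
rewrite rmorphN rmorph1 in aNa.
have := adjointZ 'i%C (presD pc pNa) (presD pa pNc) (adjointD pc pa pNa pNc ac aNa).
rewrite !scaleN1r /selfadjoint /adjoint.
have -> : ('i%C)^*%C *: (annih m - creat m) = maj (false, m) by
  rewrite -opprB /= scalerN -scaleNr; congr (_ *: _); simpc.
by [].
Qed.

(** A self-adjoint operator with square 1 is isometric. *)
Lemma fock_norm_maj c psi : fock_vec psi -> fock_norm (maj c psi) = fock_norm psi.
Proof.
move=> f; rewrite /fock_norm -(@selfadjoint_maj c) ?maj_sqr //; exact: pres_maj.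
Qed.

Lemma sat_mword F w : all (fun c => c.2 \in F) w -> sat F (mword w).
Proof.
elim: w => [_|c w IH /= /andP[cF wF]]; first exact: sat_id.
exact: sat_comp (sat_maj cF) (IH wF).
Qed.

Lemma pres_mword w : pres (mword w).
Proof. by elim: w => //= c w IH; apply: pres_comp (@pres_maj c) IH. Qed.

Lemma fock_norm_mword w psi : fock_vec psi -> fock_norm (mword w psi) = fock_norm psi.
Proof.
move=> f; elim: w => //= c w IH; rewrite fock_norm_maj ?IH //; exact: pres_mword.
Qed.

(** Supplies what the analytic estimates require of H: it acts on finitely many modes and is
    bounded. *)
Lemma gspan_local P b A : gspan maj P b A ->
  exists F K, [/\ 0 <= K, sat F A & nbound K A].
Proof.
elim=> [|B C _ [F1 [K1 [k1 s1 b1]]] _ [F2 [K2 [k2 s2 b2]]]|a B _ [F [K [k s bd]]]|w _ _].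
- exists fset0, 0; split=> // psi f.
  by rewrite mul0r -[_ psi]/(0 : fock) fock_norm0.
- exists (F1 `|` F2)%fset, (K1 + K2); split; first exact: addr_ge0.
    by apply: satD; [apply: satW s1|apply: satW s2]; rewrite ?fsubsetUl ?fsubsetUr.
  by apply: nboundD => //; apply: sat_fock_vec; eassumption.
- exists F, (Num.sqrt (sqmod a) * K); split; first by rewrite mulr_ge0 ?sqrtr_ge0.
    exact: satZ.
  apply: nboundZ => //; rewrite ?sqrtr_ge0 ?sqr_sqrtr ?sqmod_ge0 //.
  exact: sat_fock_vec s.
exists [fset c.2 | c in w], 1; split=> //.
  by apply: sat_mword; apply/allP => c cw; apply/imfsetP; exists c.
by move=> psi f; rewrite fock_norm_mword // mul1r.
Qed.

Lemma opnorm_ub K A psi : 0 <= K -> nbound K A ->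
  fock_vec psi -> fock_norm psi <= 1 -> fock_norm (A psi) <= opnorm A.
Proof.
move=> K0 bA f n1; apply: sup_ubound; last by exists psi.
exists K => _ [phi [fp np] <-]; apply: le_trans (bA _ fp) _.
by rewrite ler_piMr.
Qed.

Lemma opnorm_le K A : 0 <= K -> nbound K A -> opnorm A <= K.
Proof.
move=> K0 bA; apply: ge_sup.
  exists (fock_norm (A 0)), 0 => //; split; first exact: fock_vec0.
  by rewrite fock_norm0.
move=> _ [phi [fp np] <-]; apply: le_trans (bA _ fp) _.
by rewrite ler_piMr.
Qed.

(** A concrete unit vector, on which lower bounds for norms are tested. *)
Definition vacuum : fock := fun I => (I == fset0)%:R.

Lemma fock_vec_vacuum : fock_vec vacuum.
Proof.
by apply/fock_vecP; exists [fset fset0] => I; rewrite /vacuum inE => /negPf ->.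
Qed.

Lemma fock_norm_vacuum : fock_norm vacuum = 1.
Proof.
rewrite (@fock_normE _ _ [fset fset0]); last first.
  by move=> I; rewrite /vacuum inE => /negPf ->.
by rewrite big_seq_fset1 /vacuum eqxx /sqmod /= expr1n expr0n addr0 sqrtr1.
Qed.

Lemma opnorm_mword w : opnorm (mword w) = 1.
Proof.
have b1 : nbound 1 (mword w) by move=> psi f; rewrite fock_norm_mword // mul1r.
apply/eqP; rewrite eq_le opnorm_le //=.
rewrite -{1}fock_norm_vacuum -(fock_norm_mword w fock_vec_vacuum).
by apply: opnorm_ub b1 fock_vec_vacuum _; rewrite ?ler01 ?fock_norm_vacuum.
Qed.

Lemma nbound_ge0 K A : nbound K A -> 0 <= K.
Proof.
move=> /(_ _ fock_vec_vacuum); rewrite fock_norm_vacuum mulr1.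
exact/le_trans/fock_norm_ge0.
Qed.

Lemma pres_cj c A : pres A -> pres (cj c A).
Proof. by move=> pA; exact: pres_comp (pres_comp (@pres_maj c) pA) (@pres_maj c). Qed.

Lemma nbound_cj K c A : pres A -> nbound K A -> nbound K (cj c A).
Proof.
move=> pA bA psi f; rewrite /cj /= fock_norm_maj; last by apply: pA; apply: pres_maj.
by rewrite -(fock_norm_maj c f); apply: bA; apply: pres_maj.
Qed.

Lemma sqmod_half : sqmod (2^-1 : R[i]) = (2^-1) ^+ 2.
Proof.
have -> : (2^-1 : R[i]) = (2^-1 : R)%:C by rewrite fmorphV rmorph_nat.
by rewrite /sqmod /= expr0n addr0.
Qed.

Lemma nbound_mid K A B : pres A -> pres B -> nbound K A -> nbound K B ->
  nbound K (2^-1 *: (A + B)).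
Proof.
move=> pA pB bA bB; rewrite (_ : K = 2^-1 * (K + K)); last by field.
apply: nboundZ; rewrite ?sqmod_half ?invr_ge0 //; first exact: presD.
exact: nboundD.
Qed.

Lemma pres_twirl c A : pres A -> pres (twirl c A).
Proof. by move=> pA; apply: presZ; apply: presD => //; apply: pres_cj. Qed.

Lemma pres_twirls cs A : pres A -> pres (twirls cs A).
Proof. by move=> pA; elim: cs => //= c cs IH; apply: pres_twirl. Qed.

(** The conjugating operators are isometric, so averaging costs no factor, however many letters are
    averaged over. *)
Lemma nbound_twirls K cs A : pres A -> nbound K A -> nbound K (twirls cs A).
Proof.
move=> pA bA; elim: cs => //= c cs IH.
have pT := pres_twirls cs pA.
by apply: nbound_mid => //; [apply: pres_cj|apply: nbound_cj].
Qed.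

Lemma selfadjointD A B : pres A -> pres B ->
  selfadjoint A -> selfadjoint B -> selfadjoint (A + B).
Proof. by move=> pA pB sA sB; apply: adjointD. Qed.

Lemma selfadjointZ a A : pres A -> a^*%C = a ->
  selfadjoint A -> selfadjoint (a *: A).
Proof. by move=> pA ra sA; have := adjointZ a pA pA sA; rewrite ra. Qed.

Lemma selfadjointB A B : pres A -> pres B ->
  selfadjoint A -> selfadjoint B -> selfadjoint (A - B).
Proof.
move=> pA pB sA sB; rewrite -scaleN1r; apply: selfadjointD => //.
  exact: presZ.
by apply: selfadjointZ => //; rewrite rmorphN rmorph1.
Qed.

Lemma selfadjoint_cj c A : pres A -> selfadjoint A -> selfadjoint (cj c A).
Proof.
move=> pA sA phi psi fp fq; rewrite /cj /=.
by rewrite selfadjoint_maj ?sA ?selfadjoint_maj //; do ?[apply: pA|apply: pres_maj].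
Qed.

Lemma selfadjoint_twirls cs A : pres A -> selfadjoint A -> selfadjoint (twirls cs A).
Proof.
move=> pA sA; elim: cs => //= c cs IH; have pT := pres_twirls cs pA.
apply: selfadjointZ; first by apply: presD => //; apply: pres_cj.
  by rewrite fmorphV rmorph_nat.
by apply: selfadjointD => //; [apply: pres_cj|apply: selfadjoint_cj].
Qed.

End OpNorm.

(** * The double commutator at time zero *)

Section SmallTime.
Variables (R : realType) (M : countType).
Notation fock := (fock R M).
Notation op := (op R M).
Implicit Types (phi psi : fock) (A B H : op) (F : {fset M}) (t : R).

Lemma commE A B : comm A B = (A \o B) - (B \o A).
Proof. by []. Qed.

Lemma lin_comm A B : lin A -> lin B -> lin (comm A B).
Proof.
move=> lA lB; rewrite commE -scaleN1r.
exact: lin_add (lin_comp lA lB) (lin_scale (-1) (lin_comp lB lA)).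
Qed.

Lemma evolveE H t A psi :
  evolve H t A psi = expop ((0 +i* t) *: H) (A (expop ((0 -i* t) *: H) psi)).
Proof. by []. Qed.

Lemma nbound_comm K A B : pres A -> pres B -> 0 <= K ->
  nbound K A -> nbound 1 B -> nbound (K + K) (comm A B).
Proof.
move=> pA pB K0 bA bB; rewrite commE; apply: nboundB.
- exact: pres_comp.
- exact: pres_comp.
- by move=> psi f; apply: le_trans (bA _ (pB _ f)) _;
    rewrite ler_wpM2l //; apply: le_trans (bB _ f) _; rewrite mul1r.
by move=> psi f; apply: le_trans (bB _ (pA _ f)) _; rewrite mul1r; apply: bA.
Qed.

Lemma sat_comm F A B : sat F A -> sat F B -> sat F (comm A B).
Proof.
move=> sA sB; rewrite commE -scaleN1r.
exact: satD (sat_comp sA sB) (satZ (-1) (sat_comp sB sA)).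
Qed.

Lemma sat_evolve F H t A : sat F H -> sat F A -> sat F (evolve H t A).
Proof.
move=> sH sA.
have sp := sat_expop (satZ (0 +i* t) sH); have sm := sat_expop (satZ (0 -i* t) sH).
exact: sat_comp (sat_comp sp sA) sm.
Qed.

Section Estimate.
Variables (F : {fset M}) (H A : op) (k : R).
Hypotheses (lH : lin H) (sH : sat F H) (bH : nbound k H) (k0 : 0 <= k).
Hypotheses (lA : lin A) (sA : sat F A) (bA : nbound 1 A).

(** Used with u = t and u = -t, the generators of the two exponentials in [evolve]. *)
Lemma nbound_generator (u : R) t : 0 <= t -> u ^+ 2 = t ^+ 2 ->
  nbound (t * k) ((0 +i* u) *: H).
Proof.
move=> t0 ut; apply: nboundZ => //; first exact: sat_fock_vec sH.
by rewrite /sqmod /= expr0n add0r.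
Qed.

(* With g = tk and r+ , r- the quadratic remainders of e^{itH} and e^{-itH},
   the error is A r- + t^2 HAH psi + itHA r- + r+. *)
Lemma evolve_expansion t psi : 0 <= t -> t * k <= 2^-1 -> fock_vec psi ->
  fock_norm (evolve H t A psi - A psi - (0 +i* t) *: comm H A psi) <=
  8 * (t * k) ^+ 2 * fock_norm psi.
Proof.
move=> t0 tk2 fp; rewrite evolveE.
set g := t * k in tk2 *; have g0 : 0 <= g by rewrite mulr_ge0.
have g02 : 0 <= g <= 2^-1 by rewrite g0.
pose Gp : op := (0 +i* t) *: H; pose Gm : op := (0 -i* t) *: H.
have sp : sat F Gp by exact: satZ.
have sm : sat F Gm by exact: satZ.
have bp : nbound g Gp by exact: nbound_generator.
have bm : nbound g Gm by apply: nbound_generator => //; rewrite sqrrN.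
have lGp : lin Gp by exact: lin_scale.
have [pp pm] := (sat_fock_vec sp, sat_fock_vec sm).
have pA := sat_fock_vec sA.
pose r1 := expop Gm psi - psi - Gm psi.
have fNG phi : fock_vec phi -> fock_vec (- phi).
  by move=> f; rewrite -scaleN1r; apply: fock_vecZ.
have fr1 : fock_vec r1.
  apply: fock_vecD; last by apply: fNG; apply: pm.
  by apply: fock_vecD; [apply: (sat_fock_vec (sat_expop sm))|apply: fNG].
have nr1 : fock_norm r1 <= 2 * g ^+ 2 * fock_norm psi := expop_remainder sm bm g02 fp.
have ev : expop Gm psi = psi + Gm psi + r1.
  by rewrite /r1 -[expop Gm psi - _ - _]addrA -opprD [RHS]addrC subrK.
pose v := expop Gm psi.
have fv : fock_vec v := sat_fock_vec (sat_expop sm) fp.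
pose r2 := expop Gp (A v) - A v - Gp (A v).
have fAv : fock_vec (A v) by exact: pA.
have fr2 : fock_vec r2.
  apply: fock_vecD; last by apply: fNG; apply: pp.
  by apply: fock_vecD; [apply: (sat_fock_vec (sat_expop sp))|apply: fNG].
have nr2 : fock_norm r2 <= 2 * g ^+ 2 * fock_norm (A v) := expop_remainder sp bp g02 fAv.
have ew : expop Gp (A v) = A v + Gp (A v) + r2.
  by rewrite /r2 -[expop Gp (A v) - _ - _]addrA -opprD [RHS]addrC subrK.
have eAv : A v = A psi + A (Gm psi) + A r1 by rewrite /v ev !(linD lA).
have eGm : A (Gm psi) = - ((0 +i* t) *: A (H psi)).
  rewrite /Gm opZE (linZ lA) -scaleNr; congr (_ *: _).
  by apply/eqP; rewrite eq_complex /= oppr0 !eqxx.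
have -> : expop Gp (A v) - A psi - (0 +i* t) *: comm H A psi =
    A r1 + Gp (A (Gm psi)) + Gp (A r1) + r2.
  rewrite ew {2}eAv !(linD lGp) {1}eAv {1}eGm.
  rewrite -[comm H A psi]/(H (A psi) - A (H psi)) scalerBr -[Gp (A psi)]/((0 +i* t) *: H (A psi)).
  apply/funext => I; rewrite !fctE; ring.
have le1 phi : fock_vec phi -> fock_norm (A phi) <= fock_norm phi.
  by move=> f; apply: le_trans (bA f) _; rewrite mul1r.
set n := fock_norm psi in nr1 *.
have n0 : 0 <= n := fock_norm_ge0 psi.
have h1 : fock_norm (A r1) <= 2 * g ^+ 2 * n := le_trans (le1 _ fr1) nr1.
have hG : fock_norm (Gm psi) <= g * n := bm _ fp.
have h2 : fock_norm (Gp (A (Gm psi))) <= g * (g * n).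
  apply: le_trans (bp _ _) _; first by apply/pA/pm.
  by rewrite ler_wpM2l //; apply: le_trans (le1 _ _) hG; apply: pm.
have h3 : fock_norm (Gp (A r1)) <= g * (2 * g ^+ 2 * n).
  apply: le_trans (bp _ _) _; first exact: pA.
  by rewrite ler_wpM2l.
have h4 : fock_norm (A v) <= n + g * n + 2 * g ^+ 2 * n.
  apply: le_trans (le1 _ fv) _; rewrite /v ev.
  apply: le_trans (fock_normD _ fr1) _; first by apply: fock_vecD => //; apply: pm.
  by rewrite lerD //; apply: le_trans (fock_normD fp (pm _ fp)) _; rewrite lerD.
(* For g at most 1/2, 1 + g + 2 g^2 is at most 2. *)
have h5 : fock_norm (A v) <= 2 * n.
  apply: le_trans h4 _; rewrite (_ : _ + _ = (1 + g + 2 * g ^+ 2) * n); last by ring.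
  rewrite ler_wpM2r //.
  nra.
have h6 : fock_norm r2 <= 4 * g ^+ 2 * n.
  apply: le_trans nr2 _; rewrite (_ : 4 * _ * _ = 2 * g ^+ 2 * (2 * n)); last by ring.
  by rewrite ler_wpM2l // mulr_ge0 ?exprn_ge0.
have f1 := pA _ fr1; have f2 := pp _ (pA _ (pm _ fp)); have f3 := pp _ (pA _ fr1).
have f12 := fock_vecD f1 f2; have f123 := fock_vecD f12 f3.
(* In units of g^2 n the four terms contribute at most 2, 1, 1 and 4, whence the constant 8. *)
apply: le_trans (fock_normD f123 fr2) _.
have := fock_normD f12 f3; have := fock_normD f1 f2.
have h3' : g * (2 * g ^+ 2 * n) <= g ^+ 2 * n.
  have := sqr_ge0 g; rewrite (_ : g * _ = (g ^+ 2 * n) * (2 * g)); last by ring.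
  by move=> g2; rewrite ler_piMr ?mulr_ge0 //; lra.
have h2' : g * (g * n) = g ^+ 2 * n by ring.
rewrite h2' in h2; have := le_trans h3 h3'.
set x := g ^+ 2 * n in h2 h3' *.
rewrite -mulrA -/x in h1; rewrite -mulrA -/x in h6; rewrite -[8 * _ * _]mulrA -/x.
lra.
Qed.
End Estimate.

(** As A and B commute, the commutator at time t is itD + O(t^2) with D = [[H,A],B]. Dividing by t
    and letting t decrease to 0 leaves the bound delta for D. *)
Lemma double_comm_bound F H A B (k delta : R) (f : R -> R) :
  lin H -> sat F H -> nbound k H ->
  lin A -> sat F A -> nbound 1 A -> lin B -> sat F B -> nbound 1 B ->
  (forall psi, A (B psi) = B (A psi)) ->
  (forall t, 0 < t -> opnorm (comm (evolve H t A) B) <= f t) ->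
  f t / t @[t --> 0^'+] --> delta ->
  nbound delta (comm (comm H A) B).
Proof.
move=> lH sH bH lA sA bA lB sB bB AB fle fd.
have k0 := nbound_ge0 bH.
set D := comm (comm H A) B.
have sAH := sat_comm sH sA; have sD : sat F D := sat_comm sAH sB.
have lAH := lin_comm lH lA; have lD := lin_comm lAH lB.
have [[pA pB] pD] := (sat_fock_vec sA, sat_fock_vec sB, sat_fock_vec sD).
have le1 C phi : nbound 1 C -> fock_vec phi -> fock_norm (C phi) <= fock_norm phi.
  by move=> bC fp; apply: le_trans (bC _ fp) _; rewrite mul1r.
have expansion t psi : 0 <= t -> t * k <= 2^-1 -> fock_vec psi ->
    fock_norm (comm (evolve H t A) B psi - (0 +i* t) *: D psi) <=
    16 * (t * k) ^+ 2 * fock_norm psi.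
  move=> t0 tk fp.
  pose E phi := evolve H t A phi - A phi - (0 +i* t) *: comm H A phi.
  have nE phi : fock_vec phi -> fock_norm (E phi) <= 8 * (t * k) ^+ 2 * fock_norm phi.
    by move=> fphi; apply: (evolve_expansion lH sH bH k0 lA sA bA).
  (* The terms of order zero, AB and BA, cancel. The remainder E survives once after B and once
     before it, which doubles 8 into 16. *)
  have -> : comm (evolve H t A) B psi - (0 +i* t) *: D psi = E (B psi) - B (E psi).
    rewrite /E !(linB lB) !(linZ lB) -AB.
    rewrite -[comm _ _ psi]/(evolve H t A (B psi) - B (evolve H t A psi)).
    rewrite -[D psi]/(comm H A (B psi) - B (comm H A psi)).
    by apply/funext => I; rewrite !fctE /GRing.scale /=; ring.
  have fE phi : fock_vec phi -> fock_vec (E phi).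
    have pev := sat_fock_vec (sat_evolve t sH sA).
    have pE : pres (evolve H t A - A - (0 +i* t) *: comm H A).
      by apply: presB; [by apply: presB|apply: presZ; exact: sat_fock_vec sAH].
    exact: pE.
  have := fock_normB (fE _ (pB _ fp)) (pB _ (fE _ fp)).
  move=> /le_trans; apply.
  have := le_trans (le1 _ _ bB (fE _ fp)) (nE _ fp).
  have := le_trans (nE _ (pB _ fp)) (ler_wpM2l (mulr_ge0 (ler0n _ 8) (sqr_ge0 (t * k))) (le1 _ _ bB fp)).
  lra.
(* A crude bound, needed only to see that the commutator C below is bounded, so that [opnorm C]
   dominates its values on the unit ball. *)
have bD : nbound (k + k + (k + k)) D.
  apply: nbound_comm => //; rewrite ?addr_ge0 //; first exact: sat_fock_vec sAH.
  by apply: nbound_comm => //; apply: sat_fock_vec sH.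
set K := k + k + (k + k) in bD; have K0 : 0 <= K by rewrite !addr_ge0.
have normD t psi : 0 <= t -> fock_vec psi ->
    fock_norm ((0 +i* t) *: D psi) = t * fock_norm (D psi).
  move=> t0 fp; apply: fock_normZ_eq => //; first exact: pD.
  by rewrite /sqmod /= expr0n add0r.
have small psi : fock_vec psi -> fock_norm psi <= 1 -> fock_norm (D psi) <= delta.
  move=> fp np.
  have cv : f t / t + 16 * k ^+ 2 * t @[t --> 0^'+] --> delta.
    rewrite -[delta]addr0; apply: cvgD => //.
    rewrite -[X in _ --> X](mulr0 (16 * k ^+ 2)); apply: cvgMr.
    exact: cvg_at_right_filter.
  have e := cvg_lim (@Rhausdorff R) cv; rewrite -e.
  apply: limr_ge; first by apply/cvg_ex; exists delta.
  (* Times below this threshold satisfy tk <= 1/2; k + 1 instead of k covers k = 0. *)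
  have kp : 0 < (2 * (k + 1))^-1 by rewrite invr_gt0; lra.
  near=> t.
  have t0 : 0 < t by near: t; exact: nbhs_right_gt.
  have tk : t * k <= 2^-1.
    have : t < (2 * (k + 1))^-1 by near: t; exact: nbhs_right_lt.
    rewrite invfM => /ltW tle.
    apply: le_trans (ler_wpM2r k0 tle) _.
    rewrite -mulrA ler_piMr ?invr_ge0 // mulrC ler_pdivrMr; lra.
  set C := comm (evolve H t A) B.
  have pC : pres C := sat_fock_vec (sat_comm (sat_evolve t sH sA) sB).
  have bC : nbound (t * K + 16 * (t * k) ^+ 2) C.
    move=> phi fphi; have := expansion _ _ (ltW t0) tk fphi.
    set u := (0 +i* t) *: D phi => eu; rewrite -[C phi](subrK u).
    have fu : fock_vec u by apply/fock_vecZ/pD.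
    have fCu : fock_vec (C phi - u).
      by apply: fock_vecD; [apply: pC|rewrite -scaleN1r; apply: fock_vecZ].
    apply: le_trans (fock_normD fCu fu) _.
    rewrite addrC mulrDl lerD // normD ?(ltW t0) // -mulrA ler_wpM2l ?(ltW t0) //.
    exact: bD.
  have C0 : 0 <= t * K + 16 * (t * k) ^+ 2 by exact: nbound_ge0 bC.
  have Cf := le_trans (opnorm_ub C0 bC fp np) (fle _ t0).
  have := expansion _ _ (ltW t0) tk fp; rewrite -/C.
  set u := (0 +i* t) *: D psi => eu.
  have fu : fock_vec u by apply/fock_vecZ/pD.
  have fCu : fock_vec (C psi - u).
    by apply: fock_vecD; [apply: pC|rewrite -scaleN1r; apply: fock_vecZ].
  have := fock_normB (pC _ fp) fCu; rewrite opprB addrCA subrr addr0.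
  rewrite {1}/u normD ?(ltW t0) // => le1'.
  have le2 : 16 * (t * k) ^+ 2 * fock_norm psi <= 16 * (t * k) ^+ 2.
    by rewrite ler_piMr // mulr_ge0 ?sqr_ge0.
  rewrite -(ler_pM2l t0) (_ : t * (_ + _) = f t + 16 * (t * k) ^+ 2); first lra.
  by field; rewrite gt_eqF.
(* By homogeneity the bound passes from the unit ball to all vectors of finite support. *)
move=> psi fp; have [n0|n0] := eqVneq (fock_norm psi) 0.
  have D0 : D 0 = 0 := lin0 lD.
  by rewrite n0 mulr0 (fock_norm_eq0 fp n0) D0 fock_norm0.
have np : 0 < fock_norm psi by rewrite lt_def n0 fock_norm_ge0.
pose a : R[i] := ((fock_norm psi)^-1)%:C.
have na phi : fock_vec phi -> fock_norm (a *: phi) = (fock_norm psi)^-1 * fock_norm phi.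
  move=> fphi; apply: fock_normZ_eq; rewrite ?invr_ge0 ?(ltW np) //.
  by rewrite /sqmod /= expr0n addr0.
have := small (a *: psi) (fock_vecZ a fp).
have -> : D (a *: psi) = a *: D psi := linZ lD a psi.
rewrite !na //; last exact: pD.
rewrite mulVf // => /(_ (lexx 1)).
by rewrite ler_pdivrMl // mulrC.
Unshelve. all: by end_near.
Qed.

End SmallTime.

(** * Components of a Hamiltonian *)

Section LatticeTwirl.
Variables (R : realType) (D d : nat).
Notation lop := (op R (mode D d)).
Notation lletter := (letter (mode D d)).
Notation maj := (@maj R (mode D d)).
Notation mword := (word maj).
Notation mspan := (gspan maj).
Implicit Types (A B H : lop) (P : pred lletter) (X L : {fset site D})
  (x y : site D) (s : seq (site D)).

Definition at_site x : pred lletter :=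
  fun l => if l.2 is inl (y, _) then y == x else false.

Definition site_letters x : seq lletter :=
  [seq (b, inl (x, j)) | b <- [:: true; false], j <- enum 'I_d].

Lemma mem_site_letters x l : (l \in site_letters x) = at_site x l.
Proof.
apply/allpairsP/idP => [[[b j] [_ _ ->]]|]; first exact: eqxx.
case: l => b [[y j]|//] /eqP yx; exists (b, j); rewrite /= yx mem_enum.
by case: b.
Qed.

(** [twirls (site_letters x)] is E_x, so a step is 1 - E_x or E_x. *)
Definition site_step X x A : lop :=
  if x \in X then A - twirls (site_letters x) A else twirls (site_letters x) A.

Definition component X s A : lop := foldr (site_step X) A s.

Lemma site_stepD X x A B : site_step X x (A + B) = site_step X x A + site_step X x B.
Proof. by rewrite /site_step twirlsD; case: ifP => // _; rewrite opprD addrACA. Qed.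

Lemma site_step0 X x : site_step X x 0 = 0.
Proof. by rewrite /site_step twirls0 subr0; case: ifP. Qed.

Lemma component0 X s : component X s 0 = 0.
Proof. by elim: s => //= x s ->; rewrite site_step0. Qed.

Lemma componentD X s A B : component X s (A + B) = component X s A + component X s B.
Proof. by elim: s => //= x s ->; rewrite site_stepD. Qed.

Lemma component_sum X s (I : Type) (r : seq I) (F : I -> lop) :
  component X s (\sum_(i <- r) F i) = \sum_(i <- r) component X s (F i).
Proof.
elim: r => [|i r IH]; first by rewrite !big_nil component0.
by rewrite !big_cons componentD IH.
Qed.

Lemma lin_sub A B : lin A -> lin B -> lin (A - B).
Proof.
by move=> lA lB; rewrite -scaleN1r; exact: lin_add lA (lin_scale (-1) lB).
Qed.

Lemma lin_site_step X x A : lin A -> lin (site_step X x A).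
Proof.
move=> lA; rewrite /site_step; case: ifP => _; last exact: lin_twirls.
exact: lin_sub lA (lin_twirls _ lA).
Qed.

Lemma lin_component X s A : lin A -> lin (component X s A).
Proof. by move=> lA; elim: s => //= x s IH; apply: lin_site_step. Qed.

Lemma site_step_comm X x y A : lin A ->
  site_step X x (site_step X y A) = site_step X y (site_step X x A).
Proof.
move=> lA; rewrite /site_step.
case: ifP => _; case: ifP => _; rewrite ?twirlsB ?(twirls_comm (site_letters x)) //.
by rewrite !opprB !addrA [LHS]addrAC [RHS]addrAC; congr (_ + _); rewrite addrAC.
Qed.

(** The steps commute, so the one at x can be made to act first. This places the factors at the
    extremal pair directly next to H. *)
Lemma component_rem X s x A : lin A -> x \in s ->
  component X s A = component X (rem x s) (site_step X x A).
Proof.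
move=> lA; elim: s => //= y s IH; rewrite inE eq_sym.
have [<- _|yx /= /IH ->] := eqVneq y x; last by [].
by elim: s {IH} => //= z s <-; rewrite site_step_comm //; apply: lin_component.
Qed.

Lemma mspan_site_step X x P A : mspan P false A ->
  mspan [pred l | P l && (at_site x l ==> (x \in X))] false (site_step X x A).
Proof.
move=> sA; have sT := mspan_twirls (site_letters x) sA.
rewrite /site_step; case: ifP => xX.
  apply: (@gspanW _ _ _ P) => [l Pl|]; first by rewrite inE /= implybT andbT.
  by apply: gspanB => //; apply: gspanW sT => l /andP[].
by apply: gspanW sT => l /andP[]; rewrite mem_site_letters inE /= => /negPf-> ->.
Qed.

(** A step at a site off X erases the letters there and no step creates new ones; for s = L this
    gives the locality of the component. *)
Lemma mspan_component X s P A : mspan P false A ->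
  mspan [pred l | P l && all (fun x => at_site x l ==> (x \in X)) s] false
    (component X s A).
Proof.
move=> sA; elim: s => [|x s IH]; first by apply: gspanW sA => l Pl; rewrite inE andbT.
apply: gspanW (mspan_site_step X x IH) => l.
by rewrite !inE /= -andbA [all _ _ && _]andbC.
Qed.

(** The steps already applied introduce no letter at x, so E_x fixes their result and 1 - E_x
    annihilates it. *)
Lemma component_eq0 X s x P A : mspan P false A -> x \in s -> x \in X ->
  (forall l, at_site x l -> ~~ P l) -> component X s A = 0.
Proof.
move=> sA + xX xP; elim: s => //= y s IH; rewrite inE.
have [<- _|_ /IH ->] := eqVneq x y; last by rewrite site_step0.
rewrite /site_step xX (twirls_id _ (mspan_component X s sA)) ?subrr // => l.
by rewrite mem_site_letters => /xP /negPf; rewrite inE /= => ->.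
Qed.

Lemma component_congr X Y s A : {in s, X =i Y} -> component X s A = component Y s A.
Proof.
elim: s => //= x s IH XY; rewrite IH; last by move=> y ys; apply: XY; rewrite inE ys orbT.
by rewrite /site_step XY // mem_head.
Qed.

Lemma perm_fpowerset_fset1U x X : x \notin X ->
  perm_eq (fpowerset (x |` X)) (fpowerset X ++ [seq x |` Y | Y <- fpowerset X]).
Proof.
move=> xX; have sub Y : Y \in fpowerset X -> x \notin Y.
  by rewrite fpowersetE => /fsubsetP YX; apply: contra xX => /YX.
apply: uniq_perm; first exact: fset_uniq.
  rewrite cat_uniq fset_uniq map_inj_in_uniq ?fset_uniq ?andbT /=.
    apply/hasPn => _ /mapP[Y _ ->]; apply/negP => /sub.
    by rewrite fset1U1.
  by move=> Y Z /sub xY /sub xZ e; rewrite -(fsetU1K xY) e fsetU1K.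
move=> Y; rewrite fpowersetE mem_cat fpowersetE.
have [xY|xY] := boolP (x \in Y).
  have -> : (Y `<=` X)%fset = false.
    by apply/negP => /fsubsetP/(_ _ xY); rewrite (negPf xX).
  apply/idP/mapP => [YX|[Z ZX ->]].
    exists (Y `\ x); rewrite ?fsetD1K // fpowersetE.
    apply/fsubsetP => z; rewrite !inE => /andP[zx /(fsubsetP YX)].
    by rewrite !inE (negPf zx).
  by apply: fsetUS; rewrite -fpowersetE.
have -> : (Y \in [seq x |` Z | Z <- fpowerset X]) = false.
  by apply/negP => /mapP[Z _ e]; rewrite e fset1U1 in xY.
rewrite orbF; apply/fsubsetP/fsubsetP => YX z zY; last by rewrite inE YX ?orbT.
have := YX _ zY; rewrite !inE => /orP[/eqP zx|//].
by rewrite -zx zY in xY.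
Qed.

(** Expansion of the product of the factors E_x + (1 - E_x) = 1. In the induction, the terms of X
    and of X with x added carry complementary steps at x and add up to the term without a step
    there. *)
Lemma sum_component s A : uniq s ->
  \sum_(X <- fpowerset [fset x in s]) component X s A = A.
Proof.
elim: s => [_|x s IH /= /andP[xs us]].
  by rewrite (_ : [fset _ in _] = fset0) ?fpowerset0 ?big_seq_fset1 //; apply/fsetP => y; rewrite !inE.
rewrite (_ : [fset y in x :: s] = x |` [fset y in s]); last first.
  by apply/fsetP => y; rewrite !inE.
have xs' : x \notin [fset y in s] by rewrite inE.
rewrite (perm_big _ (perm_fpowerset_fset1U xs')) big_cat big_map /= -big_split /=.
rewrite -[RHS](IH us); apply: eq_big_seq => X.
rewrite fpowersetE => /fsubsetP Xs.
have xX : x \notin X by apply: contra xs' => /Xs.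
rewrite (@component_congr (x |` X) X); last first.
  by move=> y ys; rewrite !inE; case: eqVneq ys => // ->; rewrite (negPf xs).
by rewrite /site_step (negPf xX) fset1U1 addrC subrK.
Qed.

Lemma pres_component X s A : pres A -> pres (component X s A).
Proof.
move=> pA; elim: s => //= x s IH; rewrite /site_step.
by case: ifP => _; [apply: presB => //|]; apply: pres_twirls.
Qed.

Lemma selfadjoint_component X s A : pres A -> selfadjoint A ->
  selfadjoint (component X s A).
Proof.
move=> pA sA; elim: s => //= x s IH; rewrite /site_step.
have pC := pres_component X s pA.
case: ifP => _; last exact: selfadjoint_twirls.
by apply: selfadjointB => //; [apply: pres_twirls|apply: selfadjoint_twirls].
Qed.

Lemma nbound_component (K : R) X s A : pres A -> nbound K A ->
  nbound (2 ^+ count (mem X) s * K) (component X s A).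
Proof.
move=> pA bA; elim: s => [|x s IH] /=; first by rewrite mul1r.
have pC := pres_component X s pA; have bT := nbound_twirls (site_letters x) pC IH.
rewrite /site_step; case: ifP => _; last by [].
rewrite exprS -mulrA mulr_natl mulr2n; apply: nboundB => //.
exact: pres_twirls.
Qed.

(** Convexity is used twice, first over the words at x, then over those at y. *)
Lemma nbound_double_step (X : {fset site D}) x y H (delta : R) :
  lin H -> pres H -> x \in X -> y \in X ->
  (forall v w, {subset v <= site_letters x} -> {subset w <= site_letters y} ->
     nbound delta ((H - cjs v H) - cjs w (H - cjs v H))) ->
  nbound delta (site_step X y (site_step X x H)).
Proof.
move=> lH pH xX yX hyp.
have pcjs w A : pres A -> pres (cjs w A).
  by move=> pA; elim: w => //= c w; apply: pres_cj.
have lcjs w A : lin A -> lin (cjs w A).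
  by move=> lA; elim: w => //= c w; apply: lin_cj.
have mid K A B : K - 2^-1 *: (A + B) = 2^-1 *: ((K - A) + (K - B)) :> lop.
  by rewrite addrACA -opprD scalerBr half2.
rewrite /site_step xX yX.
set cx := site_letters x; set cy := site_letters y.
(* The bounded expression is affine in Z, so the bound survives midpoints; [pres] is bundled in
   because the norm estimates need finite supports. *)
pose Q Z := pres Z /\ nbound delta ((H - Z) - twirls cy (H - Z)).
suff [] : Q (twirls cx H) by [].
apply: twirls_convex => // [B C [pB qB] [pC qC]|v vx].
  split; first by apply: presZ; apply: presD.
  rewrite mid twirlsZ twirlsD -scalerBr opprD addrACA.
  have p Z : pres Z -> pres ((H - Z) - twirls cy (H - Z)).
    by move=> pZ; apply: presB; [|apply: pres_twirls]; apply: presB.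
  by apply: nbound_mid => //; apply: p.
split; first exact: pcjs.
set K := H - cjs v H; have pK : pres K by apply: presB => //; apply: pcjs.
pose Q' Z := pres Z /\ nbound delta (K - Z).
suff [] : Q' (twirls cy K) by [].
apply: twirls_convex => [|B C [pB qB] [pC qC]|w wy].
- by apply: lin_sub => //; apply: lcjs.
- split; first by apply: presZ; apply: presD.
  by rewrite mid; apply: nbound_mid => //; apply: presB.
- by split; [apply: pcjs|apply: hyp].
Qed.

End LatticeTwirl.

(** * The main theorem *)

Section DoubleWord.
Variables (R : realType) (M : countType).
Notation op := (op R M).
Notation maj := (@maj R M).
Notation mword := (word maj).

(* With A, B the words, (H - AHA^-1) - B(H - AHA^-1)B^-1 = [[H,A],B] A^-1 B^-1. *)
Lemma nbound_double_conj (H : op) (v w : seq (letter M)) (delta : R) :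
  ~~ odd (size v) -> {in w, forall c, c \notin v} ->
  nbound delta (comm (comm H (mword v)) (mword w)) ->
  nbound delta ((H - cjs v H) - cjs w (H - cjs v H)).
Proof.
move=> ev dvw bD psi fp.
set A := mword v; set B := mword w; pose A' := mword (rev v); pose B' := mword (rev w).
have AA' phi : A (A' phi) = phi by exact: mword_rev.
have BB' phi : B (B' phi) = phi by exact: mword_rev.
have AB phi : B (A phi) = A (B phi) by exact: mword_even_comm.
have A'B phi : B (A' phi) = A' (B phi).
  apply: mword_even_comm; rewrite ?size_rev // => c cw.
  by rewrite mem_rev; apply: dvw.
have fB' : fock_vec (B' psi) by apply: pres_mword.
have fA' : fock_vec (A' (B' psi)) by apply: pres_mword.
(* Inverse words are isometric, so the norm of psi may be replaced by that of A^-1 B^-1 psi; the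
   inequality needed is then an equality of vectors followed by [bD]. *)
rewrite -(fock_norm_mword (rev w) fp) -(fock_norm_mword (rev v) fB').
apply: le_trans (bD _ fA'); rewrite le_eqVlt; apply/orP; left; apply/eqP.
congr fock_norm; rewrite !cjsE.
rewrite -[LHS]/(H psi - A (H (A' psi)) - B (H (B' psi) - A (H (A' (B' psi))))).
rewrite -[RHS]/(H (A (B (A' (B' psi)))) - A (H (B (A' (B' psi)))) -
  B (H (A (A' (B' psi))) - A (H (A' (B' psi))))).
by rewrite A'B BB' !AA'.
Qed.

Lemma cvg_rderiv0 (f : R -> R) : f 0 = 0 -> differentiable_ge0 f ->
  f t / t @[t --> 0^'+] --> rderiv0 f.
Proof.
move=> f0 [_ cf]; rewrite /rderiv0 (_ : (fun t => f t / t) = dquot0 f) //.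
by apply/funext => t; rewrite /dquot0 f0 subr0.
Qed.

End DoubleWord.

(** * Extremal pairs of sites and use of the commutator hypothesis *)

Section Main.
Variables (R : realType) (D d : nat).
Notation lop := (op R (mode D d)).
Notation maj := (@maj R (mode D d)).
Notation mword := (word maj).
Notation mspan := (gspan maj).

Lemma gdist_eq0 (x y : site D) : (gdist x y == 0)%N = (x == y).
Proof.
apply/eqP/eqP => [/eqP|->]; last by rewrite /gdist big1 // => i _; rewrite subrr.
rewrite /gdist sum_nat_eq0 => /forallP e; apply/ffunP => i.
by apply/eqP; rewrite -subr_eq0 -absz_eq0; apply: implyP (e i) _.
Qed.

Lemma bigmax_seq_attained (T : eqType) (s : seq T) (F : T -> nat) : s != [::] ->
  exists2 i, i \in s & \max_(i <- s) F i = F i.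
Proof.
elim: s => // a [|b s] IH _; first by exists a; rewrite ?inE // big_seq1.
have [//|i is_ e] := IH _; rewrite big_cons e.
have [le|_] := leqP (F a) (F i); first by exists i; rewrite // inE is_ orbT.
by exists a; rewrite ?mem_head.
Qed.

Lemma diam_attained (X : {fset site D}) : (2 <= #|` X|)%N ->
  exists x y, [/\ x \in X, y \in X, x != y & diam X = gdist x y].
Proof.
move=> X2; have X0 : enum_fset X != [::] by rewrite -size_eq0 -lt0n ltnW.
have [x xX ex] := bigmax_seq_attained (fun x => \max_(y <- X) gdist x y) X0.
have [y yX ey] := bigmax_seq_attained (gdist x) X0.
exists x, y; split=> //; last by rewrite /diam ex.
(* A second point z makes the largest distance from x positive, so y differs from x. *)
have [z zX xz] : exists2 z, z \in X & z != x.
  have : #|` X `\ x| != 0%N by move: X2; rewrite (cardfsD1 x) xX add1n ltnS lt0n.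
  rewrite cardfs_eq0 => /fset0Pn[z]; rewrite !inE => /andP[zx zX]; by exists z.
rewrite -gdist_eq0 -ey -lt0n.
apply: leq_trans (leq_bigmax_seq z _ _) => //.
by rewrite lt0n gdist_eq0 eq_sym.
Qed.

Lemma mspan_hamiltonian (Phi : {fset site D} -> lop) L : potential Phi ->
  mspan (fun l => modes L fset0 l.2) false (hamiltonian Phi L) /\
  selfadjoint (hamiltonian Phi L).
Proof.
move=> pPhi.
rewrite (_ : hamiltonian Phi L = \sum_(X <- fpowerset L) Phi X); last first.
  apply/funext => psi; apply/funext => I; by rewrite !fct_sumE.
rewrite big_seq; apply: (big_ind (fun A => mspan _ false A /\ selfadjoint A)).
- split; first exact: gspan0.
  by move=> phi psi _ _; rewrite !(@innerE _ _ fset0) ?big_seq_fset0; [|left|right].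
- move=> A B [sA aA] [sB aB]; split; first exact: gspanD.
  have [F [K [_ /sat_fock_vec pA _]]] := gspan_local sA.
  have [F' [K' [_ /sat_fock_vec pB _]]] := gspan_local sB.
  exact: selfadjointD.
move=> X; rewrite fpowersetE => XL; have [/even_algP eX aX] := pPhi L X XL.
split=> //; apply: gspanW eX => -[b [[x j]|s]] //.
exact: (fsubsetP XL x).
Qed.


Variables (Phi : {fset site D} -> lop) (h : R -> nat -> R).
Hypotheses (pPhi : potential Phi)
  (h0 : forall r, (0 < r)%N -> h 0 r = 0)
  (dh : forall r, differentiable_ge0 (fun t => h t r))
  (hC : forall (L : {fset site D}) (x y : site D) (S1 S2 : {fset nat}) (t : R),
     x \in L -> y \in L -> x != y -> [disjoint S1 & S2]%fset -> 0 <= t ->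
     (Cmax Phi L x y S1 S2 t <= (h t (gdist x y))%:E)%E).

Lemma mword_neq0 w : mword w <> @op0 _ _.
Proof.
move=> e; have := fock_norm_mword w (fock_vec_vacuum R _).
rewrite e fock_norm_vacuum -[op0 _]/(0 : fock R (mode D d)) fock_norm0 => /eqP.
by rewrite eq_sym oner_eq0.
Qed.

(** Words have operator norm 1, so the quotient in [Cmax] is the norm of the commutator itself. One
    auxiliary mode on each side, numbered 0 and 1, is all that is used. *)
Lemma opnorm_comm_le L x y t v w : x \in L -> y \in L -> x != y -> 0 <= t ->
  all (fun l => modes [fset x] [fset 0%N] l.2) v -> ~~ odd (size v) ->
  all (fun l => modes [fset y] [fset 1%N] l.2) w -> ~~ odd (size w) ->
  opnorm (comm (tau Phi L t (mword v)) (mword w)) <= h t (gdist x y).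
Proof.
move=> xL yL xy t0 av ev aw ew.
have S12 : [disjoint [fset 0%N] & [fset 1%N]]%fset by rewrite fdisjoint1X inE.
rewrite -lee_fin; apply: le_trans (hC xL yL xy S12 t0).
apply: ereal_sup_ubound; exists (mword v), (mword w); split.
- by apply/even_algP; apply: gspan_word => //; apply/negbTE.
- by apply/even_algP; apply: gspan_word => //; apply/negbTE.
- exact: mword_neq0.
- exact: mword_neq0.
by rewrite !opnorm_mword mulr1 divr1.
Qed.

(* A word of odd length is made even by an auxiliary Majorana operator, which
   commutes with the even Hamiltonian. *)
Lemma nbound_double_cjs L x y v w : x \in L -> y \in L -> x != y ->
  {subset v <= site_letters d x} -> {subset w <= site_letters d y} ->
  let H := hamiltonian Phi L in
  nbound (rderiv0 (fun t => h t (gdist x y))) ((H - cjs v H) - cjs w (H - cjs v H)).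
Proof.
move=> xL yL xy vx wy H.
have [sH _] := mspan_hamiltonian L pPhi.
have lH : lin H := gspan_lin (@lin_maj _ _) sH.
pose pad n (u : seq (letter (mode D d))) := if odd (size u) then (true, inr n) :: u else u.
have epad n u : ~~ odd (size (pad n u)) by rewrite /pad; case: ifP => //= ->.
have cpad n u A : mspan (fun l => modes L fset0 l.2) false A -> cjs (pad n u) A = cjs u A.
  move=> sA; rewrite /pad; case: ifP => // _ /=.
  exact: cj_id (mspan_cjs u sA).
have sK : mspan (fun l => modes L fset0 l.2) false (H - cjs v H).
  by apply: gspanB => //; apply: mspan_cjs.
have apad z n u : {subset u <= site_letters d z} ->
    all (fun l => modes [fset z] [fset n] l.2) (pad n u).
  move=> uz; have au : all (fun l => modes [fset z] [fset n] l.2) u.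
    apply/allP => -[b m] /uz; rewrite mem_site_letters /at_site /=.
    by case: m => [[z' j]|//] zz'; rewrite /= inE.
  by rewrite /pad; case: ifP => //= _; rewrite au inE eqxx.
rewrite -(cpad 1%N w) // -(cpad 0%N v) //.
set v' := pad 0%N v; set w' := pad 1%N w.
have av := apad x 0%N v vx; have aw := apad y 1%N w wy.
have ev : ~~ odd (size v') by apply: epad.
have ew : ~~ odd (size w') by apply: epad.
have dwv : {in w', forall c, c \notin v'}.
  move=> c cw; apply/negP => cv.
  have := allP av _ cv; have := allP aw _ cw.
  case: c {cw cv} => b [[z j]|n] /=; rewrite !inE => /eqP-> // /eqP e.
  by rewrite e eqxx in xy.
apply: nbound_double_conj => //.
have [F0 [k [k0 sF0 bH]]] := gspan_local sH.
(* One finite set of modes on which H and both words act, auxiliary modes included. *)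
pose F := (F0 `|` [fset c.2 | c in v' ++ w'])%fset.
have sw u : {subset u <= v' ++ w'} -> sat F (mword u).
  move=> uvw; apply: sat_mword; apply/allP => c /uvw cvw.
  by rewrite inE; apply/orP; right; apply/imfsetP; exists c.
have b1 u : nbound 1 (mword u) by move=> psi f; rewrite fock_norm_mword // mul1r.
apply: (@double_comm_bound _ _ F H (mword v') (mword w') k _ (fun t => h t (gdist x y))) => //.
- by apply: satW sF0; apply: fsubsetUl.
- exact: lin_mword.
- by apply: sw => c cv; rewrite mem_cat cv.
- exact: lin_mword.
- by apply: sw => c cw; rewrite mem_cat cw orbT.
- by move=> psi; apply/esym/mword_even_comm.
- by move=> t t0; apply: opnorm_comm_le => //; apply: ltW.
apply: cvg_rderiv0 => //; apply: h0.
by rewrite lt0n gdist_eq0.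
Qed.

End Main.

Theorem theorem7 (R : realType) (k : nat) :
  exists m_k : R,
  forall (D d : nat) (Phi : {fset site D} -> op R (mode D d))
    (h : R -> nat -> R),
  potential Phi -> kbody k Phi ->
  (forall r : nat, (0 < r)%N -> h 0 r = 0) ->
  (forall r : nat, differentiable_ge0 (fun t => h t r)) ->
  (forall (L : {fset site D}) (x y : site D) (S1 S2 : {fset nat}) (t : R),
     x \in L -> y \in L -> x != y -> [disjoint S1 & S2] -> 0 <= t ->
     (Cmax Phi L x y S1 S2 t <= (h t (gdist x y))%:E)%E) ->
  forall L : {fset site D},
  exists hPhi : {fset site D} -> op R (mode D d),
    [/\ potential_on L hPhi, kbody_on L k hPhi, same_evolution L Phi hPhi &
        forall X : {fset site D}, X `<=` L -> (2 <= #|` X|)%N ->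
          opnorm (hPhi X) <= m_k * rderiv0 (fun t => h t (diam X))].
Proof.
(* At most k - 2 factors 1 - E_z remain besides those at x and y; the count below is simply bounded
   by the size of X, at most k. *)
exists (2 ^+ k) => D d Phi h pPhi kPhi h0 dh hC L.
set H := hamiltonian Phi L.
have [sH aH] := mspan_hamiltonian L pPhi.
have [F [K [_ /sat_fock_vec pH _]]] := gspan_local sH.
have lH : lin H := gspan_lin (@lin_maj _ _) sH.
exists (fun X => component X L H).
have kzero X : (X `<=` L)%fset -> (k < #|` X|)%N -> component X L H = @op0 _ _.
  move=> XL kX.
  rewrite /H (_ : hamiltonian Phi L = \sum_(Z <- fpowerset L) Phi Z); last first.
    by apply/funext => psi; apply/funext => I; rewrite !fct_sumE.
  rewrite component_sum big_seq big1 // => Z; rewrite fpowersetE => ZL.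
  have [kZ|Zk] := ltnP k #|` Z|.
    by rewrite (kPhi L Z ZL kZ); apply: component0.
  have [x xX xZ] : exists2 x, x \in X & x \notin Z.
    have : ~~ (X `<=` Z)%fset.
      by apply: contraL kX => /fsubset_leq_card/leq_trans/(_ Zk); rewrite -leqNgt.
    by move=> /fsubsetPn[x xX xZ]; exists x.
  have [/even_algP eZ _] := pPhi L Z ZL.
  apply: (component_eq0 eZ _ xX); first exact: (fsubsetP XL).
  by move=> -[b [[y j]|n]] //= /eqP ->.
split=> //.
- move=> X XL; split; last by apply: selfadjoint_component.
  apply/even_algP; apply: gspanW (mspan_component X L sH) => -[b [[x j]|n]] //=.
  rewrite inE /= => /andP[xL /allP/(_ _ xL)].
  by rewrite /at_site /= eqxx.
(* The components add up to H exactly, so the two evolutions have the same generator. *)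
- have eH : hamiltonian (fun X => component X L H) L = H.
    apply/funext => psi; apply/funext => I.
    have LE (s : seq (site D)) : s = L -> [fset x in s]%fset = L.
      by move=> ->; apply/fsetP => x; rewrite !inE.
    have := sum_component H (fset_uniq L); rewrite LE // => e.
    by rewrite -{2}e /hamiltonian !fct_sumE.
  by move=> S t A _; rewrite /tau eH.
move=> X XL X2; have [x [y [xX yX xy dX]]] := diam_attained X2.
have [xL yL] := (fsubsetP XL _ xX, fsubsetP XL _ yX).
have bXY := nbound_double_step lH pH xX yX
  (fun v w => @nbound_double_cjs _ _ _ Phi h pPhi h0 dh hC L x y v w xL yL xy).
rewrite dX; set delta := rderiv0 _ in bXY *.
(* Nonnegativity of the slope is read off from its being a norm bound. *)
have delta0 := nbound_ge0 bXY.
have d0 : 0 <= 2 ^+ k * delta by rewrite mulr_ge0 ?exprn_ge0.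
(* Beyond k sites the component vanishes; otherwise at most k factors of 2 occur. *)
have [kX|Xk] := ltnP k #|` X|.
  rewrite kzero //; apply: opnorm_le => // psi f.
  by rewrite -[op0 _]/(0 : fock R (mode D d)) fock_norm0 mulr_ge0 ?fock_norm_ge0.
apply: opnorm_le => //.
have yL' : y \in rem x L.
  by rewrite rem_filter ?fset_uniq // mem_filter /= eq_sym xy.
rewrite (component_rem X lH xL) (component_rem X (lin_site_step X x lH) yL').
have pXY := pres_component X [:: y; x] pH.
apply: nboundW (nbound_component X (rem y (rem x L)) pXY bXY).
rewrite ler_wpM2r // ler_weXn2l ?ler1n //; apply: leq_trans _ Xk.
have sub : subseq (rem y (rem x L)) L.
  exact: subseq_trans (rem_subseq y _) (rem_subseq x _).
apply: leq_trans (leq_count_subseq _ sub) _; rewrite -size_filter.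
apply: uniq_leq_size; first by rewrite filter_uniq ?fset_uniq.
by move=> z; rewrite mem_filter => /andP[].
Qed.
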